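(* Let $p(\cdot):\mathbb{R}^2\to[1,\infty)$ be a measurable function with $2\le p_-\le p_+<\infty$ that is log-Hölder continuous at infinity. Then there exist constants $C>0$ and $N_0>1$, independent of $N$ (they may depend on $p(\cdot)$), such that for every $N\ge N_0$ and every constant $c_N>0$ for which $p(\cdot)$ is $N$-modified locally log-Hölder continuous with constant $c_N$, the Kakeya (Nikodym) maximal operator $K_N$ is bounded from $L^{p(\cdot)}(\mathbb{R}^2)$ to $L^{p(\cdot)}(\mathbb{R}^2)$ and $$\|K_N\|_{L^{p(\cdot)}(\mathbb{R}^2)\to L^{p(\cdot)}(\mathbb{R}^2)}\le C\,N^{p_-c_N}(\log N)^{2/p_-}.$$
   Context: For a measurable function $p(\cdot):\mathbb{R}^2\to[1,\infty)$, write $p_-=\operatorname{ess\,inf}_{x\in\mathbb{R}^2}p(x)$ and $p_+=\operatorname{ess\,sup}_{x\in\mathbb{R}^2}p(x)$. The variable Lebesgue space $L^{p(\cdot)}(\mathbb{R}^2)$ is the set of measurable functions $f$ such that $\rho_{p(\cdot)}(f/\lambda)=\int_{\mathbb{R}^2}\left(|f(x)|/\lambda\right)^{p(x)}\,dx<\infty$ for some $\lambda>0$, with norm $\|f\|_{L^{p(\cdot)}(\mathbb{R}^2)}=\inf\{\lambda>0:\rho_{p(\cdot)}(f/\lambda)\le 1\}$. $p(\cdot)$ is log-Hölder continuous at infinity if there exist constants $c_\infty$ and $p(\infty)$ such that $|p(x)-p(\infty)|\log(e+|x|)\le c_\infty$ for all $x\in\mathbb{R}^2$. For a real number $N>1$,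 $p(\cdot)$ is $N$-modified locally log-Hölder continuous with constant $c_N>0$ if $$\left|\frac1{p(x)}-\frac1{p(y)}\right|\log\left(\frac{N}{|x-y|^2}\right)\le c_N\log N\qquad\text{for all (distinct) } x,y\in\mathbb{R}^2 \text{ with } |x-y|<\sqrt N .$$ $\mathcal{B}_N$ denotes the set of all rectangles in $\mathbb{R}^2$ (of arbitrary size, position and orientation) with eccentricity $N$, i.e. for which the ratio of the length of the long sides to that of the short sides equals $N$. For a locally integrable function $f$ on $\mathbb{R}^2$, the Kakeya (Nikodym) maximal operator is $$K_Nf(x)=\sup_{x\in R\in\mathcal{B}_N}\frac{1}{|R|}\int_R|f(y)|\,dy .$$ $\|K_N\|_{L^{p(\cdot)}(\mathbb{R}^2)\to L^{p(\cdot)}(\mathbb{R}^2)}$ is the operator norm, i.e. the smallest constant $A$ such that $\|K_Nf\|_{L^{p(\cdot)}(\mathbb{R}^2)}\le A\|f\|_{L^{p(\cdot)}(\mathbb{R}^2)}$ for all $f\in L^{p(\cdot)}(\mathbb{R}^2)$. *)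

(* Defs.v *)
From HB Require Import structures.
From mathcomp Require Import all_boot all_order all_algebra.
From mathcomp Require Import all_classical all_reals all_analysis.
From mathcomp Require Import measurable_realfun ess_sup_inf.

Set Implicit Arguments.
Unset Strict Implicit.
Unset Printing Implicit Defensive.

Import Order.TTheory GRing.Theory Num.Theory.
Import numFieldNormedType.Exports.

Local Open Scope classical_set_scope.
Local Open Scope ring_scope.

(* R * R with its Lebesgue (not merely Borel) measurable sets: the
   Caratheodory sigma-algebra of the outer measure of the product measure. *)
Definition plane (R : realType) : Type :=
  caratheodory_type (mu_ext (@lebesgue_measure R \x @lebesgue_measure R)%E).

HB.instance Definition _ (R : realType) := Measurable.on (plane R).

Definition leb2 {R : realType} : set (plane R) -> \bar R :=
  @completed_measure_extension _ _ R (@lebesgue_measure R \x @lebesgue_measure R)%E.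

HB.instance Definition _ (R : realType) := Measure.on (@leb2 R).

(* The canonical norm on R * R is the sup norm, hence these explicit
   Euclidean versions. *)
Definition enorm {R : realType} (x : plane R) : R :=
  Num.sqrt (x.1 ^+ 2 + x.2 ^+ 2).

Definition edist {R : realType} (x y : plane R) : R :=
  Num.sqrt ((x.1 - y.1) ^+ 2 + (x.2 - y.2) ^+ 2).

Section variable_exponent.
Context {R : realType}.
Implicit Types (p : plane R -> R) (F : plane R -> \bar R) (f : plane R -> R).

Definition p_minus p : \bar R := ess_inf leb2 (EFin \o p).

Definition p_plus p : \bar R := ess_sup leb2 (EFin \o p).

Definition log_holder_infty p : Prop :=
  exists cinf pinf : R, forall x : plane R,
    `|p x - pinf| * ln (expR 1 + enorm x) <= cinf.

Definition modified_log_holder (N c : R) p : Prop :=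
  forall x y : plane R, x <> y -> edist x y < Num.sqrt N ->
    `|(p x)^-1 - (p y)^-1| * ln (N / edist x y ^+ 2) <= c * ln N.

Local Open Scope ereal_scope.

(* Functions are extended-real valued here because a maximal function may
   take the value +oo; x `^ r maps +oo to +oo when r > 0. *)
Definition modular p F : \bar R := \int[leb2]_x (`|F x| `^ p x).

Definition scale (l : R) F : plane R -> \bar R := fun x => (l^-1)%:E * F x.

Definition in_Lp p F : Prop :=
  measurable_fun [set: plane R] F /\
  exists2 l : R, (0 < l)%R & modular p (scale l F) < +oo.

Definition Lp_norm p F : \bar R :=
  ereal_inf [set l%:E | l in
    [set l : R | (0 < l)%R /\ modular p (scale l F) <= 1]].

Definition op_bound p (T : (plane R -> R) -> plane R -> \bar R) (A : R) : Prop :=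
  forall f, in_Lp p (EFin \o f) ->
    Lp_norm p (T f) <= A%:E * Lp_norm p (EFin \o f).

Definition bounded_Lp p (T : (plane R -> R) -> plane R -> \bar R) : Prop :=
  (forall f, in_Lp p (EFin \o f) -> in_Lp p (T f)) /\
  exists2 A : R, (0 <= A)%R & op_bound p T A.

Definition op_norm p (T : (plane R -> R) -> plane R -> \bar R) : \bar R :=
  ereal_inf [set A%:E | A in [set A : R | (0 <= A)%R /\ op_bound p T A]].

End variable_exponent.

Section kakeya.
Context {R : realType}.

(* Centre c, half-side a along the unit vector u, half-side b along the
   orthogonal direction (- u.2, u.1). *)
Definition rectangle (c u : R * R) (a b : R) : set (plane R) :=
  [set y | `|(y.1 - c.1) * u.1 + (y.2 - c.2) * u.2| <= a /\
           `|(y.2 - c.2) * u.1 - (y.1 - c.1) * u.2| <= b].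

Definition rectangles (N : R) : set (set (plane R)) :=
  [set S | exists c u : R * R, exists s : R,
     [/\ u.1 ^+ 2 + u.2 ^+ 2 = 1, 0 < s & S = rectangle c u (N * s) s]].

Local Open Scope ereal_scope.

Definition average (f : plane R -> R) (S : set (plane R)) : \bar R :=
  (leb2 S)^-1 * \int[leb2]_(y in S) `|(f y)%:E|.

Definition kakeya (N : R) (f : plane R -> R) (x : plane R) : \bar R :=
  ereal_sup [set average f S | S in [set S | rectangles N S /\ S x]].

End kakeya.

(* Main.v *)
(* Kakeya rectangles are covered by parallelograms with rational parameters, so
   the maximal operator is dominated by a countable supremum of averages. For
   finitely many tiles with disjoint selected subsets, duality reduces the L^2
   bound to a quadratic form in the pairwise overlaps |P cap Q| / (|P| |Q|).
   If Q is not longer than P, then |P cap Q| / |Q| is at most a constant times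
   2^-j, where 2^j compares the height of Q transverse to P with the width of P,
   and Q lies in the dilate of P that is 2^j times wider. Only O(log N) dilates
   occur and they have eccentricity at most N again. Hence the best constant B
   for n tiles, which is finite, satisfies B <= K sqrt B with K = O(log N), so
   B <= K^2 uniformly in n.

   For the variable exponent, split f at height 1. On the large part, the
   modified log-Hoelder condition makes the exponent nearly constant on each
   rectangle R: with 1/q = min(1/2, 1/p(x) + delta), Jensen's inequality gives
   (avg f)^p(x) <= (12 N^c)^p(x) (avg f^(p/2))^2, because |R|^-(1/q - 1/p(x)) is
   at most 6 N^c. On the small part, log-Hoelder decay compares p with its limit
   p(oo) up to the integrable error (e + |x|)^-4. In both cases the L^2 bound
   finishes the proof. *)
Require Import Defs.
From mathcomp Require Import all_boot all_order all_algebra.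
From mathcomp Require Import all_classical all_reals all_analysis.
From mathcomp Require Import measurable_realfun ess_sup_inf ring lra.

Set Implicit Arguments.
Unset Strict Implicit.
Unset Printing Implicit Defensive.

Import Order.TTheory GRing.Theory Num.Theory.
Import numFieldNormedType.Exports.

Local Open Scope classical_set_scope.
Local Open Scope ring_scope.

(** * Overlaps of finitely many tiles *)

(** The bootstrap on B works because dilating a tile stays inside the class of tiles. For this
    reason tiles have eccentricity at most N instead of exactly N, and the width of a dilate is
    capped by its length. The selected subsets serve the dilates unchanged. Height 1 is the right
    place to cut f. Values at least 1 have powers that increase with the exponent, so on a rectangle
    the exponent may be lowered to the constant q. Values at most 1 stay so under averaging, so the
    decay at infinity can exchange p(x) and p(oo) both before and after the maximal operator. Both
    parts give a modular of order (log N)^2. Passing from modular to norm extracts a root of order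
    p_-, whence (log N)^(2/p_-). The constant 12 is 6 times the factor 2 lost in a form of Jensen's
    inequality derived from a pointwise bound. One more obstacle: p_- is an essential infimum, while
    the exponent is compared with it at every point. The modified log-Hoelder condition makes 1/p
    continuous, which closes this gap. *)

Section gram.
Context d (T : measurableType d) (R : realType) (mu : {measure set T -> \bar R}).

Lemma integrable_indic_lty (A : set T) : measurable A -> (mu A < +oo)%E ->
  mu.-integrable setT (fun x => (\1_A x)%:E).
Proof.
move=> mA fA; apply/integrableP; split; first exact/measurable_EFinP.
rewrite (eq_integral (fun x => (\1_A x)%:E)); last first.
  by move=> x _; rewrite gee0_abs// lee_fin.
by rewrite integral_indic// setIT.
Qed.

(** Gram matrices are positive semidefinite: the form is the integral of the square of
    [\sum_i c i * \1_(A i)]. *)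
Lemma gram_indic_ge0 (I : finType) (A : I -> set T) (c : I -> R) :
  (forall i, measurable (A i)) -> (forall i, (mu (A i) < +oo)%E) ->
  0 <= \sum_i \sum_k c i * c k * fine (mu (A i `&` A k)).
Proof.
move=> mA fA.
have mAA i k : measurable (A i `&` A k) by exact: measurableI.
have fAA i k : (mu (A i `&` A k) < +oo)%E.
  by apply: le_lt_trans (fA i); apply: le_measure; rewrite ?inE//; exact: subIsetl.
have intAA i k : mu.-integrable setT (fun x => (c i * c k)%:E * (\1_(A i `&` A k) x)%:E)%E.
  by apply: integrableZl => //; exact: integrable_indic_lty.
have -> : \sum_i \sum_k c i * c k * fine (mu (A i `&` A k)) =
    fine (\int[mu]_x \sum_i \sum_k ((c i * c k)%:E * (\1_(A i `&` A k) x)%:E))%E.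
  rewrite integral_sum//; last by move=> i; exact: integrable_sum.
  rewrite -[LHS]/(fine (_%:E)) -sumEFin; congr fine; apply: eq_bigr => i _.
  rewrite integral_sum// -sumEFin; apply: eq_bigr => k _.
  rewrite integralZl//; last exact: integrable_indic_lty.
  by rewrite integral_indic// setIT EFinM fineK// ge0_fin_numE.
apply: fine_ge0; apply: integral_ge0 => x _.
have -> : (\sum_i \sum_k ((c i * c k)%:E * (\1_(A i `&` A k) x)%:E))%E =
   ((\sum_i c i * \1_(A i) x) ^+ 2)%:E.
  rewrite expr2 big_distrl/= -sumEFin; apply: eq_bigr => i _.
  rewrite big_distrr/= -sumEFin; apply: eq_bigr => k _.
  by rewrite indicI -EFinM/= mulrACA.
by rewrite lee_fin sqr_ge0.
Qed.

End gram.

Section dual.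
Context d (T : measurableType d) (R : realType) (mu : {measure set T -> \bar R}).
Local Notation m A := (fine (mu A)).

(** Cauchy-Schwarz for [\sum_i w i * \1_(S i)] against [\sum_k v k * \1_(E k)], obtained by
    expanding the square of [Num.sqrt B] times the second minus the first. Disjointness of the [E k]
    removes the cross terms of the second sum. *)
Lemma disjoint_bilinear_le n (E S : 'I_n -> set T) (v w : 'I_n -> R) (B : R) :
  (forall i, measurable (E i)) -> (forall i, (mu (E i) < +oo)%E) ->
  (forall i, measurable (S i)) -> (forall i, (mu (S i) < +oo)%E) ->
  trivIset setT E -> 0 < B ->
  \sum_i \sum_k w i * w k * m (S i `&` S k) <= B * \sum_i m (E i) * v i ^+ 2 ->
  \sum_i \sum_k w i * v k * m (E k `&` S i) <=
    Num.sqrt B * \sum_i m (E i) * v i ^+ 2.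
Proof.
move=> mE fE mS fS tE B0; set Q := (X in X <= _ -> _).
set V := \sum_i m (E i) * v i ^+ 2 => QB; set Y := (X in X <= _).
pose r := Num.sqrt B; have r0 : 0 < r by rewrite sqrtr_gt0.
have r2 : r * r = B by rewrite -expr2 sqr_sqrtr// ltW.
(* Both families enter a single Gram form, indexed by a sum type, with the tiles carrying a minus
   sign. *)
pose A (x : 'I_n + 'I_n) := match x with inl k => E k | inr i => S i end.
pose c (x : 'I_n + 'I_n) := match x with inl k => r * v k | inr i => - w i end.
have mA x : measurable (A x) by case: x.
have fA x : (mu (A x) < +oo)%E by case: x.
have := gram_indic_ge0 c mA fA; rewrite big_sumType/=.
under eq_bigr do rewrite big_sumType/=.
under [X in _ + X]eq_bigr do rewrite big_sumType/=.
rewrite !big_split/=.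
have -> : \sum_i \sum_k r * v i * (r * v k) * m (E i `&` E k) = B * V.
  rewrite /V mulr_sumr; apply: eq_bigr => i _; rewrite (bigD1 i)//= setIid.
  rewrite big1 ?addr0 ?expr2 -?r2; first by ring.
  move=> k ki; rewrite (_ : _ `&` _ = set0) ?measure0 ?mulr0//.
  by move/trivIsetP : tE => /(_ i k Logic.I Logic.I); apply; rewrite eq_sym.
have -> : \sum_i \sum_k r * v i * (- w k) * m (E i `&` S k) = - r * Y.
  rewrite /Y exchange_big/= mulr_sumr; apply: eq_bigr => i _.
  rewrite mulr_sumr; apply: eq_bigr => k _; ring.
have -> : \sum_i \sum_k (- w i) * (r * v k) * m (S i `&` E k) = - r * Y.
  rewrite /Y mulr_sumr; apply: eq_bigr => i _.
  rewrite mulr_sumr; apply: eq_bigr => k _; rewrite setIC; ring.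
have -> : \sum_i \sum_k (- w i) * (- w k) * m (S i `&` S k) = Q.
  by apply: eq_bigr => i _; apply: eq_bigr => k _; ring.
rewrite -/r => h; rewrite -(ler_pM2l r0) mulrA r2; nra.
Qed.

Context (X : Type) (S : X -> set T) (s : X -> R) (dil : nat -> X -> X)
  (D : X -> Prop) (J : nat) (C : R).

(** The geometric input of the L^2 argument, isolated so that it can serve both the parallelograms
    and their reflections in the diagonal. [s] orders the tiles by length, and [tile_overlap]
    concerns a tile [y] not longer than [x]: some dilate of [x] absorbs [y], and the overlap
    relative to both areas is at most [C] over the area of that dilate. *)
Record dilated_tiles : Prop := {
  tile_measurable : forall x, D x -> measurable (S x) ;
  tile_gt0 : forall x, D x -> (0 < mu (S x))%E ;
  tile_lty : forall x, D x -> (mu (S x) < +oo)%E ;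
  tile_dil : forall j x, D x -> D (dil j x) ;
  tile_sub_dil : forall j x, D x -> S x `<=` S (dil j x) ;
  tile_overlap : forall x y, D x -> D y -> s y <= s x ->
    m (S x `&` S y) = 0 \/
    exists2 j, (j <= J)%N & S y `<=` S (dil j x) /\
      m (S x `&` S y) * m (S (dil j x)) <= C * (m (S x) * m (S y)) }.

(* The integral of the square of [\sum_i v i * m (E i) / m (S (x i)) * \1_(S (x i))]. *)
Definition overlap_form n (x : 'I_n -> X) (E : 'I_n -> set T) (v : 'I_n -> R) :=
  \sum_i \sum_k v i * v k * (m (E i) * m (E k)) *
    (m (S (x i) `&` S (x k)) / (m (S (x i)) * m (S (x k)))).

(** Linearizes a maximal function: [E i] stands for the points of tile [i] at which the average over
    that tile is the chosen one. *)
Definition selection n (x : 'I_n -> X) (E : 'I_n -> set T) :=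
  [/\ forall i, D (x i), forall i, measurable (E i),
      forall i, E i `<=` S (x i) & trivIset setT E].

Definition overlap_bound n B := forall x E v, @selection n x E ->
  (forall i, 0 <= v i) ->
  overlap_form x E v <= B * \sum_i m (E i) * v i ^+ 2.

Context (DT : dilated_tiles).
Context (C0 : 0 < C).

Lemma tile_fine_gt0 x : D x -> 0 < m (S x).
Proof. by move=> Dx; rewrite fine_gt0// tile_gt0//= tile_lty. Qed.

Lemma le_fine_measure (A B : set T) : measurable A -> measurable B ->
  A `<=` B -> (mu B < +oo)%E -> m A <= m B.
Proof.
move=> mA mB AB fB; apply: fine_le.
- by rewrite ge0_fin_numE// (le_lt_trans _ fB)// le_measure// inE.
- by rewrite ge0_fin_numE.
- by rewrite le_measure// inE.
Qed.

(** The overlap density times [m (E i)] or [m (E k)] is at most 1, so AM-GM settles each pair. The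
    value is irrelevant: what matters is that some finite bound exists, from which the
    self-improvement starts. *)
Lemma overlap_bound_trivial n : overlap_bound n n%:R.
Proof.
move=> x E v [Dx mE Esub tE] v0; rewrite /overlap_form.
have e0 i : 0 <= m (E i) by rewrite fine_ge0.
have s0 i : 0 < m (S (x i)) by exact: tile_fine_gt0.
have eS i : m (E i) <= m (S (x i)).
  by apply: le_fine_measure => //; [exact: tile_measurable|exact: tile_lty].
have ovl i k : m (S (x i) `&` S (x k)) <= m (S (x i)).
  apply: le_fine_measure => //; last exact: tile_lty.
  by apply: measurableI; exact: tile_measurable.
  exact: tile_measurable.
have ovr i k : m (S (x i) `&` S (x k)) <= m (S (x k)) by rewrite setIC.
have o0 i k : 0 <= m (S (x i) `&` S (x k)) by rewrite fine_ge0.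
have key i k : v i * v k * (m (E i) * m (E k)) *
    (m (S (x i) `&` S (x k)) / (m (S (x i)) * m (S (x k)))) <=
    (m (E i) * v i ^+ 2 + m (E k) * v k ^+ 2) / 2.
  set q := _ / _.
  have q0 : 0 <= q by rewrite divr_ge0// mulr_ge0// ltW.
  have q1 : m (E i) * q <= 1.
    rewrite /q mulrA ler_pdivrMr ?mulr_gt0// mul1r ler_pM//.
  have q2 : m (E k) * q <= 1.
    rewrite /q mulrA ler_pdivrMr ?mulr_gt0// mul1r [leRHS]mulrC ler_pM//.
  apply: (@le_trans _ _ (((v i ^+ 2 + v k ^+ 2) / 2) * (m (E i) * m (E k)) * q)).
    apply: ler_wpM2r => //; apply: ler_wpM2r; first exact: mulr_ge0.
    by have := sqr_ge0 (v i - v k); nra.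
  have : v i ^+ 2 * m (E i) * (m (E k) * q) <= v i ^+ 2 * m (E i) * 1.
    by apply: ler_wpM2l => //; rewrite mulr_ge0// sqr_ge0.
  have : v k ^+ 2 * m (E k) * (m (E i) * q) <= v k ^+ 2 * m (E k) * 1.
    by apply: ler_wpM2l => //; rewrite mulr_ge0// sqr_ge0.
  lra.
apply: (@le_trans _ _ (\sum_i \sum_k (m (E i) * v i ^+ 2 + m (E k) * v k ^+ 2) / 2)).
  by apply: ler_sum => i _; apply: ler_sum => k _; exact: key.
under eq_bigr do rewrite -mulr_suml big_split/= sumr_const card_ord.
rewrite -mulr_suml big_split/= sumr_const card_ord sumrMnl.
by rewrite -[X in (X + X) / 2]mulr_natl; rewrite le_eqVlt; apply/orP; left; apply/eqP; field.
Qed.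

(** For [x k] not longer than [x i], the overlap density is replaced by [C] over the area of a
    dilate of [x i] that contains [E k]. Summing over all [k] for a fixed [j] gives a bilinear form
    to which duality applies, at the price [Num.sqrt B]. There are [J.+1] values of [j], and the 2
    accounts for the two orders of a pair. *)
Lemma overlap_bound_sqrt n B : 0 < B -> overlap_bound n B ->
  overlap_bound n (2 * (C * J.+1%:R) * Num.sqrt B).
Proof.
move=> B0 bB x E v sel v0; have [Dx mE Esub tE] := sel.
set V := \sum_i _.
have e0 i : 0 <= m (E i) by rewrite fine_ge0.
have s0 y : D y -> 0 < m (S y) by exact: tile_fine_gt0.
have o0 A : 0 <= m A by rewrite fine_ge0.
have fE i : (mu (E i) < +oo)%E.
  apply: le_lt_trans (tile_lty DT (Dx i)); apply: le_measure; rewrite ?inE//.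
  exact: tile_measurable.
pose t j i k := v i * v k * m (E i) * (m (E k `&` S (dil j (x i))) / m (S (dil j (x i)))).
have t0 j i k : 0 <= t j i k.
  by apply: mulr_ge0; [rewrite mulr_ge0// mulr_ge0|rewrite mulr_ge0// invr_ge0].
have tV j : \sum_i \sum_k t j i k <= Num.sqrt B * V.
  pose w i := v i * m (E i) / m (S (dil j (x i))).
  rewrite (_ : \sum_i _ = \sum_i \sum_k w i * v k * m (E k `&` S (dil j (x i)))); last first.
    by apply: eq_bigr => i _; apply: eq_bigr => k _; rewrite /t /w; ring.
  apply: disjoint_bilinear_le => //.
  - by move=> i; apply: tile_measurable => //; exact: tile_dil.
  - by move=> i; apply: tile_lty => //; exact: tile_dil.
  (* The dilated tiles with the same [E] again form a selection, so the assumed bound applies to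
     them with the same [B]. *)
  rewrite (_ : \sum_i _ = overlap_form (dil j \o x) E v).
    apply: bB => //; split => // i /=; first exact: tile_dil.
    by move=> y Ey; apply: tile_sub_dil => //; exact: Esub.
  apply: eq_bigr => i _; apply: eq_bigr => k _; rewrite /w/= invfM; ring.
pose q i k := v i * v k * (m (E i) * m (E k)) *
    (m (S (x i) `&` S (x k)) / (m (S (x i)) * m (S (x k)))).
have q0 i k : 0 <= q i k.
  apply: mulr_ge0; first by rewrite mulr_ge0// mulr_ge0.
  by rewrite divr_ge0// mulr_ge0.
have qC i k : q i k = q k i by rewrite /q setIC; congr (_ * (_ / _)); ring.
have qt i k : s (x k) <= s (x i) -> q i k <= C * \sum_(j < J.+1) t j i k.
  move=> ski; have [z|[j jJ [sub ov]]] := tile_overlap DT (Dx i) (Dx k) ski.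
    by rewrite /q z mul0r mulr0; apply: mulr_ge0; [exact: ltW|exact: sumr_ge0].
  rewrite (bigD1 (Ordinal (jJ : (j < J.+1)%N)))//= mulrDr ler_wpDr//.
    by apply: mulr_ge0; [exact: ltW|exact: sumr_ge0].
  have -> : t j i k = v i * v k * (m (E i) * m (E k)) / m (S (dil j (x i))).
    rewrite /t setIidl; first ring.
    by move=> y Ey; apply: sub; exact: Esub.
  have sj := s0 _ (tile_dil DT j (Dx i)).
  rewrite /q [leRHS]mulrCA; apply: ler_wpM2l; first by rewrite mulr_ge0// mulr_ge0.
  by rewrite ler_pdivrMr ?mulr_gt0 ?s0// mulrAC ler_pdivlMr.
rewrite /overlap_form.
have qsplit i k : q i k <= C * (\sum_(j < J.+1) t j i k + \sum_(j < J.+1) t j k i).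
  have tt0 i' k' : 0 <= \sum_(j < J.+1) t j i' k' by exact: sumr_ge0.
  have [h|/ltW h] := leP (s (x k)) (s (x i)); rewrite mulrDr.
    by rewrite ler_wpDr ?qt// mulr_ge0// ltW.
  by rewrite ler_wpDl// 1?qC ?qt// mulr_ge0// ltW.
apply: (le_trans (ler_sum _ (fun i _ => ler_sum _ (fun k _ => qsplit i k)))).
under eq_bigr do rewrite -mulr_sumr big_split/=.
rewrite -mulr_sumr big_split/=.
rewrite [X in _ * (_ + X)]exchange_big/=.
have tot : \sum_i \sum_k \sum_(j < J.+1) t j i k <= J.+1%:R * (Num.sqrt B * V).
  under eq_bigr do rewrite exchange_big/=.
  rewrite exchange_big/=.
  apply: (@le_trans _ _ (\sum_(j < J.+1) (Num.sqrt B * V))).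
    by apply: ler_sum => j _; exact: tV.
  by rewrite sumr_const card_ord mulr_natl.
apply: (@le_trans _ _ (C * (J.+1%:R * (Num.sqrt B * V) + J.+1%:R * (Num.sqrt B * V)))).
  by rewrite ler_pM2l// lerD.
by rewrite le_eqVlt; apply/orP; left; apply/eqP; ring.
Qed.

(** The infimum [b] of the admissible constants satisfies [b <= K * Num.sqrt B] for each admissible
    [B]. Taking the infimum over [B] gives [b ^+ 2 <= K ^+ 2 * b], and [b] is finite by the trivial
    bound. *)
Lemma overlap_bound_sqr n : overlap_bound n ((2 * (C * J.+1%:R)) ^+ 2).
Proof.
set K := 2 * _; have K0 : 0 < K by rewrite !mulr_gt0// ltr0n.
move=> x E v sel v0; set V := \sum_i _.
have V0 : 0 <= V by apply: sumr_ge0 => i _; rewrite mulr_ge0// ?sqr_ge0// fine_ge0.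
pose G := [set B : R | 0 < B /\ overlap_bound n B].
have GK B : G B -> G (K * Num.sqrt B).
  move=> [B0 bB]; split; last exact: overlap_bound_sqrt.
  by rewrite mulr_gt0// sqrtr_gt0.
have G0 : has_inf G.
  split; last by exists 0 => B [/ltW].
  exists n.+1%:R; split; first by rewrite ltr0n.
  move=> x' E' v' sel' v0'; apply: (le_trans (overlap_bound_trivial sel' v0')).
  apply: ler_wpM2r; last by rewrite ler_nat.
  by apply: sumr_ge0 => i _; rewrite mulr_ge0// ?sqr_ge0// fine_ge0.
pose b := inf G.
have b_ge0 : 0 <= b by apply: lb_le_inf; [exact: G0.1|move=> B [/ltW]].
have bB B : G B -> b <= B by move=> GB; apply: ge_inf => //; exact: G0.2.
have bK : b <= K ^+ 2.
  have [->|bp] := eqVneq b 0; first exact: sqr_ge0.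
  have b0 : 0 < b by rewrite lt_neqAle eq_sym bp.
  have : b ^+ 2 / K ^+ 2 <= b.
    apply: lb_le_inf; first exact: G0.1.
    move=> B GB; have B0 := GB.1; rewrite ler_pdivrMr ?exprn_gt0//.
    have := bB _ (GK _ GB); rewrite -(@ler_pXn2r _ 2)// ?nnegrE//; last first.
      by rewrite mulr_ge0// ?sqrtr_ge0// ltW.
    by rewrite exprMn sqr_sqrtr 1?mulrC// ltW.
  by rewrite ler_pdivrMr ?exprn_gt0// expr2 ler_pM2l.
have [Vz|Vp] := eqVneq V 0.
  have [B [B0 /(_ x E v sel v0)]] := G0.1.
  by rewrite -/V Vz !mulr0.
have Vgt0 : 0 < V by rewrite lt_neqAle eq_sym Vp.
rewrite -ler_pdivrMr//; apply: le_trans bK; apply: lb_le_inf; first exact: G0.1.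
move=> B [B0 /(_ x E v sel v0)]; by rewrite ler_pdivrMr.
Qed.

End dual.

(** * Maximal functions over countably many tiles *)

Section primal.
Context d (T : measurableType d) (R : realType) (mu : {measure set T -> \bar R}).
Local Notation m A := (fine (mu A)).
Context (X : Type) (S : X -> set T) (s : X -> R) (dil : nat -> X -> X)
  (D : X -> Prop) (J : nat) (C : R).
Context (DT : dilated_tiles mu S s dil D J C).
Context (C0 : 0 < C).

Lemma measurable_bigmax (I : Type) (r : seq I) (h : I -> T -> R) (z : R) :
  (forall i, measurable_fun setT (h i)) ->
  measurable_fun setT (fun t => \big[Num.max/z]_(i <- r) h i t).
Proof.
move=> mh; elim: r => [|i r IH].
  rewrite (_ : (fun t => _) = cst z)//.
  by apply/funext => t; rewrite big_nil.
rewrite (_ : (fun t => _) = (fun t => Num.max (h i t) (\big[Num.max/z]_(i <- r) h i t))).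
  exact: measurable_maxr.
by apply/funext => t; rewrite big_cons.
Qed.

Lemma integral_indicM (A : set T) (f : T -> R) :
  (\int[mu]_(x in A) (f x)%:E = \int[mu]_x (f x * \1_A x)%:E)%E.
Proof.
rewrite integral_mkcond; apply: eq_integral => x _.
by rewrite patchE indicE; case: ifP; rewrite (mulr1, mulr0).
Qed.

Lemma integral_Zindic (A : set T) (k : R) : 0 <= k -> measurable A ->
  (mu A < +oo)%E -> (\int[mu]_t (k%:E * (\1_A t)%:E) = (k * m A)%:E)%E.
Proof.
move=> k0 mA fA; rewrite ge0_integralZl_EFin//; last exact/measurable_EFinP.
by rewrite integral_indic// setIT EFinM fineK// ge0_fin_numE.
Qed.

Definition mean (f : T -> R) (A : set T) : R :=
  fine (\int[mu]_(x in A) (f x)%:E)%E / m A.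

Lemma mean_ge0 f A : (forall t, 0 <= f t) -> 0 <= mean f A.
Proof.
move=> f0; apply: divr_ge0; apply: fine_ge0 => //.
by apply: integral_ge0 => t _; rewrite lee_fin.
Qed.

Lemma integral_lty_sqr (A : set T) (f : T -> R) :
  measurable A -> (mu A < +oo)%E -> (forall t, 0 <= f t) -> measurable_fun setT f ->
  (\int[mu]_t (f t ^+ 2)%:E < +oo)%E -> (\int[mu]_(t in A) (f t)%:E < +oo)%E.
Proof.
move=> mA fA f0 mf f2.
have mf2 : measurable_fun setT (fun t => (f t ^+ 2)%:E).
  by apply/measurable_EFinP; exact: measurable_funX.
apply: (@le_lt_trans _ _ (\int[mu]_(t in A) (1 + (f t ^+ 2)%:E))%E).
  apply: ge0_le_integral => //.
  - by move=> t _; rewrite lee_fin.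
  - by apply/measurable_EFinP; exact: measurable_funTS.
  - by apply: emeasurable_funD => //; exact: measurable_funTS.
  - by move=> t _; rewrite -EFinD lee_fin; nra.
rewrite ge0_integralD//; first last.
  - exact: measurable_funTS.
  - by move=> t _; rewrite lee_fin sqr_ge0.
rewrite integral_cst// mul1e lte_add_pinfty//.
apply: le_lt_trans f2; apply: ge0_subset_integral => //.
by move=> t _; rewrite lee_fin sqr_ge0.
Qed.

(** With [V] the integral of the linearized maximal function, a function [H] is built such that the
    integral of [f * H] is [V] and that of [H ^+ 2] is the overlap form, at most [K2 * V]. Then [2 *
    f * H <= K2 * f ^+ 2 + K2^-1 * H ^+ 2] integrates to [2 * V <= K2 * \int f ^+ 2 + V], and the
    finite [V] is absorbed. *)
Lemma finite_maximal_le n (x : 'I_n -> X) (f : T -> R) :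
  (forall i, D (x i)) -> (forall t, 0 <= f t) -> measurable_fun setT f ->
  (\int[mu]_t (\big[Num.max/0%R]_(i < n) (mean f (S (x i)) ^+ 2 * \1_(S (x i)) t))%:E
   <= ((2 * (C * J.+1%:R)) ^+ 2)%:E * \int[mu]_t (f t ^+ 2)%:E)%E.
Proof.
move=> Dx f0 mf; set K2 := _ ^+ 2.
have K0 : 0 < K2 by rewrite exprn_gt0// mulr_gt0// mulr_gt0// ltr0n.
have mf2 : measurable_fun setT (fun t => (f t ^+ 2)%:E).
  by apply/measurable_EFinP; exact: measurable_funX.
have [f2|] := ltP (\int[mu]_t (f t ^+ 2)%:E)%E (+oo)%E; last first.
  by rewrite leye_eq => /eqP ->; rewrite gt0_muley ?lte_fin// leey.
have mS i : measurable (S (x i)) by exact: (tile_measurable DT).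
have fS i : (mu (S (x i)) < +oo)%E by exact: (tile_lty DT).
pose a i := mean f (S (x i)).
have a0 i : 0 <= a i by exact: mean_ge0.
(* [E i] is the set where tile [i] attains the maximum, the least such index being chosen. *)
pose prec (k i : 'I_n) := (a i < a k) || ((a k == a i) && (k < i)%N).
pose E i := S (x i) `\` \bigcup_(k in [set k | prec k i]) S (x k).
have mE i : measurable (E i).
  by apply: measurableD => //; apply: fin_bigcup_measurable => [|k _ //]; exact: finite_finset.
have ES i : E i `<=` S (x i) by move=> t [].
have fE i : (mu (E i) < +oo)%E.
  by apply: le_lt_trans (fS i); rewrite le_measure// inE.
have tE : trivIset setT E.
  apply/trivIsetP => i k _ _ ik; rewrite -subset0 => t [[Si ni] [Sk nk]].
  have [h|h|h] := ltgtP (a i) (a k).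
  - by apply: ni; exists k => //=; rewrite /prec h.
  - by apply: nk; exists i => //=; rewrite /prec h.
  - have [l|l|l] := ltngtP i k.
    + by apply: nk; exists i => //=; rewrite /prec h eqxx l orbT.
    + by apply: ni; exists k => //=; rewrite /prec h eqxx l orbT.
    + by move/eqP : ik; apply; exact: val_inj.
have sel : selection S D x E by split.
pose V := \sum_i m (E i) * a i ^+ 2.
have ptw t : \big[Num.max/0]_(i < n) (a i ^+ 2 * \1_(S (x i)) t) <=
    \sum_i a i ^+ 2 * \1_(E i) t.
  have s0 : 0 <= \sum_i a i ^+ 2 * \1_(E i) t.
    by apply: sumr_ge0 => i _; rewrite mulr_ge0 ?sqr_ge0.
  apply: bigmax_le => // k _; rewrite [in leLHS]indicE.
  have [tk|_] := boolP (t \in S (x k)); last by rewrite mulr0.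
  rewrite mulr1.
  (* Two choices in turn: a tile of greatest mean among those containing [t], then the least index
     [l] with that mean. This is the index for which [t] lies in [E l]. *)
  have [i ti imax] := arg_maxP a (tk : (fun k => t \in S (x k)) k).
  pose P := fun j => (t \in S (x j)) && (a j == a i).
  have Pi : P i by rewrite /P ti eqxx.
  case: (arg_minnP (fun j : 'I_n => val j) Pi) => l /andP[tl /eqP al] lmin.
  have El : t \in E l.
    rewrite inE; split; first by rewrite -inE.
    move=> [j /=]; rewrite /prec al => /orP[h|/andP[/eqP h jl]] tj.
      have : a j <= a i by apply: imax; rewrite inE.
      by rewrite leNgt h.
    have : (l <= j)%N by apply: lmin; rewrite /P h eqxx andbT inE.
    by rewrite leqNgt jl.
  rewrite (bigD1 l)//= ler_wpDr//.
    by apply: sumr_ge0 => j _; rewrite mulr_ge0 ?sqr_ge0.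
  rewrite indicE El mulr1 al lerXn2r ?nnegrE//; exact: imax.
apply: (@le_trans _ _ V%:E).
  apply: (@le_trans _ _ (\int[mu]_t \sum_i (a i ^+ 2)%:E * (\1_(E i) t)%:E)%E).
    apply: ge0_le_integral => //.
    - move=> t _; rewrite lee_fin; apply: bigmax_ge_id.
    - apply/measurable_EFinP; apply: measurable_bigmax => i.
      exact: measurable_funM.
    - apply: emeasurable_sum => i; apply/measurable_EFinP; exact: measurable_funM.
    - by move=> t _; under [leRHS]eq_bigr do rewrite -EFinM; rewrite sumEFin lee_fin.
  rewrite ge0_integral_sum//; first last.
  - by move=> i t _; rewrite lee_fin mulr_ge0 ?sqr_ge0.
  - move=> i; apply/measurable_EFinP; exact: measurable_funM.
  rewrite /V -sumEFin; apply: lee_sum => i _.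
  by rewrite integral_Zindic ?sqr_ge0// lee_fin mulrC.
have V0 : 0 <= V by apply: sumr_ge0 => i _; rewrite mulr_ge0 ?sqr_ge0 ?fine_ge0.
(* [H] is the adjoint of the linearized averaging operator applied to [\sum_i a i * \1_(E i)]. *)
pose w i := a i * m (E i) / m (S (x i)).
have w0 i : 0 <= w i.
  by apply: divr_ge0; [apply: mulr_ge0 => //|]; exact: fine_ge0.
have ww i : 0 <= 2 * w i by exact: mulr_ge0.
pose H t := \sum_i w i * \1_(S (x i)) t.
have mH : measurable_fun setT H.
  by apply: measurable_sum => i; exact: measurable_funM.
have H2 : (\int[mu]_t (H t ^+ 2)%:E = (overlap_form mu S x E a)%:E)%E.
  have -> : (fun t => (H t ^+ 2)%:E) = (fun t => \sum_i \sum_k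
      (w i * w k)%:E * (\1_(S (x i) `&` S (x k)) t)%:E)%E.
    apply/funext => t; rewrite expr2 big_distrl/= -sumEFin; apply: eq_bigr => i _.
    rewrite big_distrr/= -sumEFin; apply: eq_bigr => k _.
    by rewrite indicI -EFinM/= mulrACA.
  have mSS i k : measurable (S (x i) `&` S (x k)) by exact: measurableI.
  have mSSf i k : measurable_fun setT (fun t => ((w i * w k)%:E * (\1_(S (x i) `&` S (x k)) t)%:E)%E).
    by apply/measurable_EFinP; exact: measurable_funM.
  rewrite ge0_integral_sum//; first last.
  - move=> i t _; apply: sume_ge0 => k _; rewrite lee_fin mulr_ge0// mulr_ge0//.
  - by move=> i; apply: emeasurable_sum => k.
  rewrite /overlap_form -sumEFin; apply: eq_bigr => i _.
  rewrite ge0_integral_sum//; first last.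
  - move=> k t _; rewrite lee_fin mulr_ge0// mulr_ge0//.
  rewrite -sumEFin; apply: eq_bigr => k _.
  rewrite integral_Zindic//; first by congr EFin; rewrite /w invfM; ring.
    exact: mulr_ge0.
  by rewrite (le_lt_trans _ (fS i))// le_measure// inE.
have H2V : overlap_form mu S x E a <= K2 * V by exact: (overlap_bound_sqr DT).
have fSf i : (\int[mu]_(t in S (x i)) (f t)%:E < +oo)%E by exact: integral_lty_sqr.
have V2 : ((2 * V)%:E = \int[mu]_t (2 * f t * H t)%:E)%E.
  have -> : (fun t => (2 * f t * H t)%:E) = (fun t => \sum_i
      (2 * w i)%:E * (f t * \1_(S (x i)) t)%:E)%E.
    apply/funext => t; rewrite /H big_distrr/= -sumEFin; apply: eq_bigr => i _.
    rewrite -EFinM; congr EFin; ring.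
  have mfS i : measurable_fun setT (fun t => (f t * \1_(S (x i)) t)%:E).
    by apply/measurable_EFinP; exact: measurable_funM.
  rewrite ge0_integral_sum//; first last.
  - by move=> i t _; rewrite lee_fin; apply: mulr_ge0; [exact: ww|exact: mulr_ge0].
  - by move=> i; apply: emeasurable_funM.
  rewrite /V mulr_sumr -sumEFin; apply: eq_bigr => i _.
  rewrite ge0_integralZl_EFin ?ww//; first last.
  - by move=> t _; rewrite lee_fin mulr_ge0.
  rewrite -integral_indicM -[in RHS](@fineK _ (\int[mu]_(t in _) _)%E); last first.
    by rewrite ge0_fin_numE//; apply: integral_ge0 => t _; rewrite lee_fin.
  rewrite -EFinM; congr EFin; rewrite /w -!mulrA; congr (_ * _).
  by rewrite mulrC expr2 -!mulrA; congr (_ * _); rewrite /a /mean; ring.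
have := ge0_le_integral mu measurableT.
move=> /(_ (fun t => (2 * f t * H t)%:E) (fun t => K2%:E * (f t ^+ 2)%:E + K2^-1%:E * (H t ^+ 2)%:E)%E).
have H0 t : 0 <= H t by apply: sumr_ge0 => i _; rewrite mulr_ge0.
have mH2 : measurable_fun setT (fun t => (H t ^+ 2)%:E).
  by apply/measurable_EFinP; exact: measurable_funX.
have K2f t : 0 <= K2 * f t ^+ 2 by rewrite mulr_ge0 ?sqr_ge0// ltW.
have K2H t : 0 <= K2^-1 * H t ^+ 2 by rewrite mulr_ge0 ?sqr_ge0// invr_ge0 ltW.
move=> /(_ _ _ _ _)/wrap[].
- by move=> t _; rewrite lee_fin !mulr_ge0.
- by apply/measurable_EFinP; apply: measurable_funM => //; exact: measurable_funM.
- by apply: emeasurable_funD; exact: emeasurable_funM.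
- move=> t _; rewrite -!EFinM -EFinD lee_fin.
  rewrite -(ler_pM2l K0) mulrDr mulrA mulrA mulfV ?gt_eqF// mul1r.
  have := sqr_ge0 (K2 * f t - H t); nra.
rewrite -V2 ge0_integralD//; first last.
- exact: emeasurable_funM.
- by move=> t _; rewrite -EFinM lee_fin.
- exact: emeasurable_funM.
- by move=> t _; rewrite -EFinM lee_fin.
have sq0 (g : T -> R) t : [set: T] t -> (0 <= (g t ^+ 2)%:E)%E.
  by move=> _; rewrite lee_fin sqr_ge0.
have Ki0 : 0 <= K2^-1 by rewrite invr_ge0 ltW.
rewrite (ge0_integralZl_EFin _ measurableT (sq0 f) mf2 (ltW K0)).
rewrite (ge0_integralZl_EFin _ measurableT (sq0 H) mH2 Ki0).
rewrite H2 -(@fineK _ (\int[mu]_t _)%E); last first.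
  by rewrite ge0_fin_numE//; apply: integral_ge0 => t _; rewrite lee_fin sqr_ge0.
rewrite -!EFinM -EFinD !lee_fin => h.
have : K2^-1 * overlap_form mu S x E a <= V.
  by rewrite mulrC ler_pdivrMr// [V * _]mulrC.
lra.
Qed.

End primal.

Section countable.
Context d (T : measurableType d) (R : realType) (mu : {measure set T -> \bar R}).
Context (X : Type) (S : X -> set T) (s : X -> R) (dil : nat -> X -> X)
  (D : X -> Prop) (J : nat) (C : R).
Context (DT : dilated_tiles mu S s dil D J C).
Context (C0 : 0 < C).

Definition finite_maximal (x : nat -> X) (f : T -> R) (n : nat) (t : T) : R :=
  \big[Num.max/0%R]_(i < n) (mean mu f (S (x i)) ^+ 2 * \1_(S (x i)) t).

(** The supremum over a sequence of tiles, written as an increasing limit so that monotone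
    convergence carries over the bound, which is uniform in [n]. *)
Definition sqr_maximal (x : nat -> X) (f : T -> R) (t : T) : \bar R :=
  limn (fun n => (finite_maximal x f n t)%:E).

Lemma finite_maximal_nd (x : nat -> X) (f : T -> R) t :
  nondecreasing_seq (fun n => (finite_maximal x f n t)%:E).
Proof.
move=> p q pq; rewrite lee_fin /finite_maximal.
exact: (le_bigmax_ord xpredT (fun i => mean mu f (S (x i)) ^+ 2 * \1_(S (x i)) t)).
Qed.

Lemma sqr_maximal_cvg (x : nat -> X) (f : T -> R) t :
  (finite_maximal x f n t)%:E @[n --> \oo] --> sqr_maximal x f t.
Proof. exact/ereal_nondecreasing_is_cvgn/finite_maximal_nd. Qed.

Lemma sqr_maximal_ge (x : nat -> X) (f : T -> R) i t : S (x i) t ->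
  ((mean mu f (S (x i)) ^+ 2)%:E <= sqr_maximal x f t)%E.
Proof.
move=> Sit; apply: lime_ge.
  exact/ereal_nondecreasing_is_cvgn/finite_maximal_nd.
near=> n; rewrite lee_fin /finite_maximal.
have ni : (i < n)%N by near: n; exact: nbhs_infty_gt.
apply: le_trans (le_bigmax _ _ (Ordinal ni)) => /=.
by rewrite indicE mem_set// mulr1.
Unshelve. all: by end_near. Qed.

Lemma sqr_maximal_ge0 (x : nat -> X) (f : T -> R) t : (0 <= sqr_maximal x f t)%E.
Proof.
apply: lime_ge; first exact/ereal_nondecreasing_is_cvgn/finite_maximal_nd.
by near=> n; rewrite lee_fin; exact: bigmax_ge_id.
Unshelve. all: by end_near. Qed.

Lemma measurable_finite_maximal (x : nat -> X) (f : T -> R) n : (forall i, D (x i)) ->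
  measurable_fun setT (fun t => (finite_maximal x f n t)%:E).
Proof.
move=> Dx; apply/measurable_EFinP; apply: measurable_bigmax => i.
apply: measurable_funM => //.
by apply: measurable_indic; exact: (tile_measurable DT).
Qed.

Lemma measurable_sqr_maximal (x : nat -> X) (f : T -> R) : (forall i, D (x i)) ->
  measurable_fun setT (sqr_maximal x f).
Proof.
move=> Dx; apply: (emeasurable_fun_cvg (fun n t => (finite_maximal x f n t)%:E)).
  by move=> n; exact: measurable_finite_maximal.
by move=> t _; exact: sqr_maximal_cvg.
Qed.

Lemma integral_sqr_maximal_le (x : nat -> X) (f : T -> R) : (forall i, D (x i)) ->
  (forall t, 0 <= f t) -> measurable_fun setT f ->
  (\int[mu]_t sqr_maximal x f t
   <= ((2 * (C * J.+1%:R)) ^+ 2)%:E * \int[mu]_t (f t ^+ 2)%:E)%E.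
Proof.
move=> Dx f0 mf; rewrite /sqr_maximal monotone_convergence//.
- apply: lime_le.
    apply: ereal_nondecreasing_is_cvgn => p q pq; apply: ge0_le_integral => //.
    + by move=> t _; rewrite lee_fin; exact: bigmax_ge_id.
    + exact: measurable_finite_maximal.
    + exact: measurable_finite_maximal.
    + by move=> t _; exact: finite_maximal_nd.
  apply: nearW => n; by apply: (finite_maximal_le DT C0) => // i; exact: Dx.
- by move=> n; exact: measurable_finite_maximal.
- by move=> n t _; rewrite lee_fin; exact: bigmax_ge_id.
- by move=> t _; exact: finite_maximal_nd.
Qed.

End countable.

(** * Parallelograms and rectangles in the plane *)

Section leb2_borel.
Context {R : realType}.
Local Notation leb := (@lebesgue_measure R).
Local Notation flip := (fun x : R * R => (x.2, x.1)).

Lemma borel_plane (A : set (R * R)) : measurable A ->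
  measurable (A : set (plane R)).
Proof. by move=> mA; exact: caratheodory_measurable_mu_ext. Qed.

Lemma leb2E (A : set (R * R)) : measurable A ->
  leb2 (A : set (plane R)) = (leb \x leb)%E A.
Proof. by move=> mA; exact: measurable_mu_extE. Qed.

Lemma measurable_plane_fst : measurable_fun setT (fun x : plane R => x.1).
Proof. by move=> _ Y mY; apply: borel_plane; exact: measurable_fst. Qed.

Lemma measurable_plane_snd : measurable_fun setT (fun x : plane R => x.2).
Proof. by move=> _ Y mY; apply: borel_plane; exact: measurable_snd. Qed.

Lemma measurable_swap_preimage (A : set (R * R)) : measurable A ->
  measurable (flip @^-1` A).
Proof. by move=> mA; rewrite -[X in measurable X]setTI; exact: measurable_swap. Qed.

(** Integrating in either order gives a measure with the product value on boxes, and such a measure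
    is unique. *)
Lemma leb2_swap (A : set (R * R)) : measurable A ->
  leb2 (flip @^-1` A : set (plane R)) = leb2 (A : set (plane R)).
Proof.
move=> mA; rewrite !leb2E//; last exact: measurable_swap_preimage.
rewrite [RHS](product_measure_unique (m' := (leb \x^ leb)%E))//; last first.
  by move=> X Y mX mY; exact: product_measure2E.
Qed.

End leb2_borel.

(** * Parallelograms with vertical sides, their overlaps and dilates *)

Section parallelogram.
Context {R : realType}.
Local Notation leb := (@lebesgue_measure R).

Lemma leb2_le_strip (A : set (R * R)) (l : R -> R) (al be h : R) : measurable A ->
  0 <= h -> al <= be ->
  (forall z, A z -> al <= z.1 <= be /\ l z.1 <= z.2 <= l z.1 + h) ->
  (leb2 (A : set (plane R)) <= (h * (be - al))%:E)%E.
Proof.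
move=> mA h0 ab hA; rewrite leb2E// /product_measure1.
apply: (@le_trans _ _ (\int[leb]_x (h%:E * (\1_(`[al, be]%classic : set R) x)%:E))%E).
  apply: ge0_le_integral => //.
  - exact: measurable_fun_xsection.
  - by apply/measurable_EFinP; apply: measurable_funM => //; exact: measurable_indic.
  - move=> x _; rewrite indicE; case: (boolP (x \in _)) => [xab|xab]; rewrite /= ?mule1 ?mule0.
      apply: (@le_trans _ _ (leb `[l x, l x + h]%classic)).
        apply: le_measure; rewrite ?inE//; first exact: measurable_xsection.
        move=> y; rewrite /xsection/= inE => /hA[_ /=].
        by rewrite in_itv.
      rewrite lebesgue_measure_itv/= lte_fin; case: ifPn => _.
        by rewrite -EFinD lee_fin addrAC subrr add0r.
      by rewrite lee_fin.
    rewrite (_ : xsection A x = set0) ?measure0//.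
    rewrite -subset0 => y; rewrite /xsection/= inE => /hA[/= xx _].
    by move/negP : xab; apply; rewrite inE/= in_itv.
rewrite ge0_integralZl_EFin//; last first.
- by apply/measurable_EFinP; exact: measurable_indic.
rewrite integral_indic// setIT EFinM; apply: lee_wpmul2l => //.
rewrite [X in (X <= _)%E]lebesgue_measure_itv/= lte_fin; case: ifPn => // _.
by rewrite lee_fin subr_ge0.
Qed.

(** A parallelogram with two vertical sides around the line of slope [pslope] through its centre;
    [plen] is half its horizontal extent and [pwid] half the length of its vertical sections. The
    sections being intervals, areas and overlaps become one-dimensional. *)
Record para := Para { pcx : R ; pcy : R ; pslope : R ; plen : R ; pwid : R }.

Definition pline P (x : R) := pcy P + pslope P * (x - pcx P).

Definition pset P : set (R * R) :=
  [set z | `|z.1 - pcx P| <= plen P /\ `|z.2 - pline P z.1| <= pwid P].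

Lemma measurable_pset P : measurable (pset P).
Proof.
have m1 : measurable_fun setT (fun z : R * R => z.1) by exact: measurable_fst.
have m2 : measurable_fun setT (fun z : R * R => z.2) by exact: measurable_snd.
pose f (z : R * R) := z.1 - pcx P; pose g (z : R * R) := z.2 - pline P z.1.
have mf : measurable_fun setT f by exact: measurable_funB.
have mg : measurable_fun setT g.
  apply: measurable_funB => //; rewrite /pline; apply: measurable_funD => //.
  by apply: measurable_funM.
rewrite (_ : pset P = f @^-1` `[- plen P, plen P]%classic `&` g @^-1` `[- pwid P, pwid P]%classic).
  apply: measurableI; rewrite -[X in measurable X]setTI.
  - exact: mf.
  - exact: mg.
by apply/seteqP; split => z; rewrite /pset/= !in_itv/= !ler_norml.
Qed.

Lemma leb2_pset P : 0 <= plen P -> 0 <= pwid P ->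
  leb2 (pset P : set (plane R)) = (4 * (plen P * pwid P))%:E.
Proof.
move=> a0 b0; rewrite leb2E; last exact: measurable_pset.
transitivity (\int[leb]_x ((2 * pwid P)%:E *
    (\1_(`[pcx P - plen P, pcx P + plen P]%classic : set R) x)%:E))%E; last first.
  rewrite ge0_integralZl_EFin ?mulr_ge0//; last first.
  - by apply/measurable_EFinP; exact: measurable_indic.
  rewrite integral_indic// setIT [X in (_ * X)%E]lebesgue_measure_itv/= lte_fin.
  case: ifPn => [_|]; first by rewrite -EFinD -EFinM; congr EFin; ring.
  rewrite -leNgt => h; have -> : plen P = 0 by lra.
  by rewrite mul0r mulr0 mule0.
apply: eq_integral.
move=> x _ /=; rewrite indicE.
have E : xsection (pset P) x =
    if x \in (`[pcx P - plen P, pcx P + plen P]%classic : set R)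
    then `[pline P x - pwid P, pline P x + pwid P]%classic else set0.
  apply/seteqP; split => y; rewrite /xsection/= inE /pset/=.
    move=> [h1 h2]; rewrite mem_set/= ?in_itv/=; last by rewrite -ler_distl.
    by rewrite -ler_distl.
  case: ifPn => //; rewrite inE/= !in_itv/= => h1 h2.
  by rewrite !ler_distl.
rewrite E; case: ifPn => _; last by rewrite measure0 mule0.
rewrite lebesgue_measure_itv/= lte_fin; case: ifPn => [_|].
  by rewrite -EFinD mule1; congr EFin; ring.
rewrite -leNgt => h; have -> : pwid P = 0 by lra.
by rewrite mulr0 mul0e.
Qed.

(** The slope bound leaves room to round slopes in [-1, 1], and bounding the eccentricity by [N]
    instead of fixing it keeps the class stable under [pdil]. *)
Definition wide_para (N : R) P :=
  [/\ `|pslope P| <= 2, 0 < pwid P, pwid P <= plen P & plen P <= N * pwid P].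

(** The minimum keeps the width below the length. The factor 11 = 1 + 2 * (4 + 1) is what inclusion
    requires when the minimum is the length, 4 being the largest difference of two slopes. *)
Definition pdil (j : nat) P := Para (pcx P) (pcy P) (pslope P)
  (11 * plen P) (11 * Num.min (plen P) (2 ^+ j * pwid P)).

(* Half the variation of [z.2 - pline P z.1] over [pset Q], i.e. the half-height of [Q] measured in the direction transverse to [P]. *)
Definition pheight P Q := plen Q * `|pslope P - pslope Q| + pwid Q.

(** If [Q] is nearly parallel to [P], its transverse height is at most [2 * pwid Q], and a strip of
    height [2 * pwid P] over [Q] contains the overlap. Otherwise the two axes diverge at rate [D],
    so the overlap lies over an interval of half-length [(b + b') / D] around their crossing, with
    sections no longer than twice the smaller width. *)
Lemma pset_overlap_le N P Q : wide_para N P -> wide_para N Q ->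
  fine (leb2 (pset P `&` pset Q : set (plane R))) * pheight P Q <=
  16 * plen Q * pwid P * pwid Q.
Proof.
move=> [_ b0 ba _] [_ b0' ba' _]; rewrite /pheight.
set b := pwid P in b0 ba *; set b' := pwid Q in b0' ba' *.
set a' := plen Q in ba' *; set a := plen P in ba.
set D := `|pslope P - pslope Q|.
have D0 : 0 <= D by exact: normr_ge0.
have mPQ : measurable (pset P `&` pset Q) by apply: measurableI; exact: measurable_pset.
have a'0 : 0 < a' by lra.
have [h|h] := leP (a' * D) b'.
  have : (leb2 (pset P `&` pset Q : set (plane R)) <= ((2 * b) * (2 * a'))%:E)%E.
    rewrite (_ : 2 * a' = (pcx Q + a') - (pcx Q - a')); last by ring.
    apply: (@leb2_le_strip _ (fun x => pline P x - b)) => //; [lra|lra|].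
    move=> z [[_]]; rewrite ler_distl => h1 []; rewrite ler_distl => h2 _.
    split => //; rewrite -/b in h1; lra.
  set M := leb2 _ => hM.
  have M0 : (0 <= M)%E by exact: measure_ge0.
  have : fine M <= 2 * b * (2 * a').
    by rewrite -lee_fin fineK// ge0_fin_numE// (le_lt_trans hM)// ltry.
  have : 0 <= fine M by exact: fine_ge0.
  move: (fine M) => x x0 hx.
  apply: (@le_trans _ _ (2 * b * (2 * a') * (2 * b'))).
    by apply: ler_pM => //; [rewrite addr_ge0// ?mulr_ge0// ltW|lra].
  have : 0 < b * a' * b' by rewrite !mulr_gt0.
  lra.
have Dp : 0 < D by rewrite -(pmulr_rgt0 _ a'0); lra.
pose mn := Num.min b b'.
have mn0 : 0 < mn by rewrite lt_min b0 b0'.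
pose l := if b <= b' then (fun x => pline P x - b) else (fun x => pline Q x - b').
(* The abscissa at which the axes of [P] and [Q] cross. *)
pose x0 := ((pcy Q - pslope Q * pcx Q) - (pcy P - pslope P * pcx P)) / (pslope P - pslope Q).
have Dn0 : pslope P - pslope Q != 0 by rewrite -normr_eq0 gt_eqF.
pose r := (b + b') / D.
have r0 : 0 < r by rewrite divr_gt0// addr_gt0.
have : (leb2 (pset P `&` pset Q : set (plane R)) <= ((2 * mn) * (2 * r))%:E)%E.
  rewrite (_ : 2 * r = (x0 + r) - (x0 - r)); last by ring.
  apply: (@leb2_le_strip _ l) => //; [lra|lra|].
  move=> z [[_ h1] [_ h2]]; split.
    rewrite -ler_distl -(ler_pM2r Dp) /r divfK ?gt_eqF// /D -normrM mulrBl /x0 divfK//.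
    rewrite [X in `|X|](_ : _ = (z.2 - pline Q z.1) - (z.2 - pline P z.1)).
      2: by rewrite /pline; ring.
    by apply: (le_trans (ler_normB _ _)); rewrite [leRHS]addrC lerD.
  move: h1 h2; rewrite !ler_distl -/b -/b' /l /mn.
  by case: (leP b b') => hb h1 h2; lra.
set M := leb2 _ => hM.
have M0 : (0 <= M)%E by exact: measure_ge0.
have : fine M <= 2 * mn * (2 * r).
  by rewrite -lee_fin fineK// ge0_fin_numE// (le_lt_trans hM)// ltry.
have : 0 <= fine M by exact: fine_ge0.
move: (fine M) => x xge0 hx.
apply: (@le_trans _ _ (2 * mn * (2 * r) * (2 * (a' * D)))).
  by apply: ler_pM => //; [rewrite addr_ge0// ?mulr_ge0// ltW|lra].
rewrite [leLHS](_ : _ = 8 * a' * (mn * (r * D))); last by ring.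
rewrite /r divfK ?gt_eqF//.
have : mn * (b + b') <= 2 * (b * b').
  rewrite /mn; case: (leP b b') => hb; nra.
move=> h3; have : a' * (mn * (b + b')) <= a' * (2 * (b * b')) by rewrite ler_pM2l.
lra.
Qed.

(** A common point [w] anchors [Q]: moving from [w] inside [Q] changes the vertical distance to the
    axis of [P] by at most [2 * pheight P Q]. *)
Lemma pset_sub_dil N P Q j : wide_para N P -> wide_para N Q ->
  plen Q <= plen P -> pset P `&` pset Q !=set0 -> pheight P Q <= 2 ^+ j * pwid P ->
  pset Q `<=` pset (pdil j P).
Proof.
move=> [s2 b0 ba _] [s2' b0' ba' _] aa [w [[w1 w2] [w3 w4]]] hj z [z1 z2].
rewrite /pset/=; split.
  rewrite (_ : z.1 - pcx P = (z.1 - pcx Q) - (w.1 - pcx Q) + (w.1 - pcx P)); last by ring.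
  apply: (le_trans (ler_normD _ _)); apply: (@le_trans _ _ (plen Q + plen Q + plen P)).
    by rewrite lerD// (le_trans (ler_normB _ _))// lerD.
  lra.
have -> : pline (pdil j P) z.1 = pline P z.1 by [].
have D4 : `|pslope P - pslope Q| <= 4.
  by apply: (le_trans (ler_normB _ _)); lra.
have key : `|z.2 - pline P z.1| <= pwid P + 2 * pheight P Q.
  rewrite (_ : z.2 - pline P z.1 = (z.2 - pline Q z.1) + (w.2 - pline P w.1)
     - (w.2 - pline Q w.1) - (pslope P - pslope Q) * ((z.1 - pcx Q) - (w.1 - pcx Q))); last first.
    by rewrite /pline; ring.
  apply: (le_trans (ler_normB _ _)); rewrite normrM.
  apply: (@le_trans _ _ (pwid Q + pwid P + pwid Q + `|pslope P - pslope Q| * (plen Q + plen Q))).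
    rewrite lerD//.
      apply: (le_trans (ler_normB _ _)); rewrite lerD//.
      by apply: (le_trans (ler_normD _ _)); rewrite lerD.
    by apply: ler_wpM2l => //; apply: (le_trans (ler_normB _ _)); rewrite lerD.
  rewrite /pheight; lra.
apply: (le_trans key).
have j1 : 1 <= 2 ^+ j :> R by rewrite exprn_ege1// ler1n.
have : pwid P <= 2 ^+ j * pwid P by rewrite ler_peMl// ltW.
have : plen Q * `|pslope P - pslope Q| <= plen Q * 4 by apply: ler_wpM2l => //; lra.
rewrite /= /pheight in hj *; case: (leP (plen P) (2 ^+ j * pwid P)) => _; lra.
Qed.

(** The dilate is taken with the least [j] such that [2 ^+ j * pwid P] reaches the transverse height
    of [Q]. [J] suffices because [pheight P Q <= 5 * plen Q <= 5 * N * pwid P]. Dilating costs 11 ^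
    2 in area, and 968 = 8 * 11 ^ 2 leaves room for the other factors. *)
Lemma pset_dilated_tiles N J : 5 * N <= 2 ^+ J ->
  dilated_tiles (@leb2 R) (fun P => pset P : set (plane R)) plen pdil (wide_para N) J 968.
Proof.
move=> NJ; split.
- by move=> P _; apply: borel_plane; exact: measurable_pset.
- move=> P [_ b0 ba _]; rewrite [X in (_ < X)%E]leb2_pset; [|lra|lra].
  by rewrite lte_fin !mulr_gt0//; lra.
- by move=> P [_ b0 ba _]; rewrite [X in (X < _)%E]leb2_pset ?ltry//; lra.
- move=> j P [s2 b0 ba aN]; split => //=.
  + by rewrite mulr_gt0// lt_min mulr_gt0 ?exprn_gt0// andbT; lra.
  + by rewrite ler_pM2l// ge_min lexx.
  + rewrite mulrCA ler_pM2l//.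
    have j1 : 1 <= 2 ^+ j :> R by rewrite exprn_ege1// ler1n.
    have N0 : 1 <= N by rewrite -(ler_pM2r b0) mul1r (le_trans ba).
    case: (leP (plen P) (2 ^+ j * pwid P)) => _; first by rewrite ler_peMl//; lra.
    rewrite (le_trans aN)// ler_pM2l; [|lra]; by rewrite ler_peMl// ltW.
- move=> j P [s2 b0 ba aN] z [z1 z2]; split => /=; first lra.
  have -> : pline (pdil j P) z.1 = pline P z.1 by [].
  have j1 : 1 <= 2 ^+ j :> R by rewrite exprn_ege1// ler1n.
  have : pwid P <= 2 ^+ j * pwid P by rewrite ler_peMl// ltW.
  by case: (leP (plen P) (2 ^+ j * pwid P)) => _; lra.
move=> P Q DP DQ aa.
have [/eqP ->|/set0P ne] := boolP (pset P `&` pset Q == set0).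
  by left; rewrite measure0.
right.
have [s2 b0 ba aN] := DP; have [s2' b0' ba' aN'] := DQ.
have D4 : `|pslope P - pslope Q| <= 4.
  by apply: (le_trans (ler_normB _ _)); lra.
have hJ : pheight P Q <= 2 ^+ J * pwid P.
  apply: (@le_trans _ _ (5 * N * pwid P)); last by rewrite ler_pM2r.
  have : plen Q * `|pslope P - pslope Q| <= plen Q * 4 by apply: ler_wpM2l => //; lra.
  rewrite /pheight; lra.
have ex : exists j, pheight P Q <= 2 ^+ j * pwid P by exists J.
have [j hj jmin] := ex_minnP ex.
exists j; first exact: jmin.
split; first exact: (pset_sub_dil DP DQ).
have fpset P' : 0 <= plen P' -> 0 <= pwid P' ->
    fine (leb2 (pset P' : set (plane R))) = 4 * (plen P' * pwid P').
  by move=> ? ?; rewrite leb2_pset.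
rewrite [X in _ * X <= _](fpset (pdil j P)) /=; last 2 first.
- by lra.
- by rewrite mulr_ge0// le_min mulr_ge0 ?exprn_ge0 ?ltW//; lra.
rewrite [X in _ <= _ * (X * _)](fpset P); [|lra|lra].
rewrite [X in _ <= _ * (_ * X)](fpset Q); [|lra|lra].
have hP := pset_overlap_le DP DQ.
have M0 : 0 <= fine (leb2 (pset P `&` pset Q : set (plane R))) by exact: fine_ge0.
have MQ : fine (leb2 (pset P `&` pset Q : set (plane R))) <= 4 * (plen Q * pwid Q).
  have -> : 4 * (plen Q * pwid Q) = fine (leb2 (pset Q : set (plane R))).
    by rewrite fpset//; lra.
  apply: le_fine_measure => //.
  - by apply: borel_plane; apply: measurableI; exact: measurable_pset.
  - by apply: borel_plane; exact: measurable_pset.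
  - by rewrite [X in (X < _)%E]leb2_pset ?ltry//; lra.
move: (fine _) M0 MQ hP => M M0 MQ hP.
have AB : 0 < plen P * pwid P by rewrite mulr_gt0//; lra.
have AB' : 0 < plen Q * pwid Q by rewrite mulr_gt0//; lra.
(* For [j = 0] the dilate is comparable to [P], and bounding the overlap by the area of [Q] is
   enough. For a successor, minimality makes the width at most twice the height, so
   [pset_overlap_le] applies. *)
case: j hj jmin => [|j] hj jmin.
  rewrite expr0 mul1r.
  have -> : Num.min (plen P) (pwid P) = pwid P by apply/min_idPr.
  have : M * (plen P * pwid P) <= 4 * (plen Q * pwid Q) * (plen P * pwid P).
    by rewrite ler_pM2r.
  nra.
have hlt : 2 ^+ j * pwid P < pheight P Q.
  by rewrite ltNge; apply/negP => /jmin; rewrite ltnn.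
have : M * (11 * plen P * (11 * Num.min (plen P) (2 ^+ j.+1 * pwid P))) <=
   M * (11 * plen P * (11 * (2 * pheight P Q))).
  apply: ler_wpM2l => //; apply: ler_wpM2l; first lra.
  rewrite ler_pM2l// ge_min; apply/orP; right; rewrite exprS; lra.
have : (M * pheight P Q) * plen P <= (16 * plen Q * pwid P * pwid Q) * plen P.
  by apply: ler_wpM2r => //; lra.
rewrite /=; nra.
Qed.

End parallelogram.

(** * Comparison of rectangles with parallelograms *)

Section rectangle_geometry.
Context {R : realType}.
Implicit Types (c u : R * R) (s a b N : R).
Local Notation flip := (fun x : R * R => (x.2, x.1)).

Lemma unit_vector_le1 u : u.1 ^+ 2 + u.2 ^+ 2 = 1 -> `|u.1| <= 1 /\ `|u.2| <= 1.
Proof.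
move=> u1; have le1 (v w : R) : v ^+ 2 + w ^+ 2 = 1 -> `|v| <= 1.
  move=> vw; rewrite -(@ler_pXn2r _ 2)// ?nnegrE// expr1n real_normK ?num_real//.
  have := sqr_ge0 w; lra.
by split; [exact: le1 u1|apply: (le1 _ u.1); rewrite addrC].
Qed.

Lemma unit_vector_ge_half u : u.1 ^+ 2 + u.2 ^+ 2 = 1 -> `|u.2| <= `|u.1| ->
  1 / 2 <= `|u.1|.
Proof.
move=> u1 u21; have : `|u.2| ^+ 2 <= `|u.1| ^+ 2 by rewrite lerXn2r// nnegrE.
rewrite -(real_normK (num_real u.1)) -(real_normK (num_real u.2)) in u1.
have : 0 <= `|u.1| by []; nra.
Qed.

(** The long axis is nearer to the horizontal, so its slope is at most 1 in absolute value and
    dividing by [u.1] costs at most a factor 2. Steep rectangles are treated after exchanging the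
    coordinates. *)
Lemma rectangle_sub_pset c u a b : u.1 ^+ 2 + u.2 ^+ 2 = 1 -> `|u.2| <= `|u.1| ->
  0 < b -> b <= a ->
  rectangle c u a b `<=` pset (Para c.1 c.2 (u.2 / u.1) (2 * a) (2 * b)).
Proof.
move=> u1 u21 b0 ba z [h1 h2].
have au1 := unit_vector_ge_half u1 u21.
have un0 : u.1 != 0 by rewrite -normr_gt0; lra.
have [k1 k2] := unit_vector_le1 u1.
set x := z.1 - c.1 in h1 h2 *; set y := z.2 - c.2 in h1 h2 *.
set al := x * u.1 + y * u.2 in h1; set be := y * u.1 - x * u.2 in h2.
split => /=.
  rewrite -/x.
  have -> : x = al * u.1 - be * u.2.
    rewrite -[LHS]mulr1 -u1 /al /be; ring.
  apply: (le_trans (ler_normB _ _)); rewrite !normrM.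
  have : `|al| * `|u.1| <= a * 1 by apply: ler_pM.
  have : `|be| * `|u.2| <= b * 1 by apply: ler_pM.
  lra.
rewrite /pline/= [X in `|X|](_ : _ = be / u.1); last first.
  rewrite /be /x /y; field; exact: un0.
rewrite normrM normfV ler_pdivrMr; last lra.
have : 2 * b * (1 / 2) <= 2 * b * `|u.1| by rewrite ler_pM2l//; lra.
lra.
Qed.

Lemma pset_sub_rectangle c u a b : u.1 ^+ 2 + u.2 ^+ 2 = 1 -> `|u.2| <= `|u.1| ->
  0 < b -> b <= a ->
  pset (Para c.1 c.2 (u.2 / u.1) (a / 4) (b / 2)) `<=` rectangle c u a b.
Proof.
move=> u1 u21 b0 ba z []; rewrite /pline/= => h1 h2.
have au1 := unit_vector_ge_half u1 u21.
have un0 : u.1 != 0 by rewrite -normr_gt0; lra.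
have [k1 k2] := unit_vector_le1 u1.
set t := z.1 - c.1 in h1 h2 *; set q := z.2 - _ in h2.
have zq : z.2 - c.2 = u.2 / u.1 * t + q by rewrite /q; ring.
split; rewrite -/t zq.
  rewrite [X in `|X|](_ : _ = t * (u.1 ^+ 2 + u.2 ^+ 2) / u.1 + q * u.2); last by field; exact: un0.
  rewrite u1 mulr1; apply: (le_trans (ler_normD _ _)); rewrite !normrM normfV.
  have : `|t| / `|u.1| <= a / 2.
    rewrite ler_pdivrMr; last lra.
    have : a / 2 * (1 / 2) <= a / 2 * `|u.1| by rewrite ler_pM2l//; lra.
    lra.
  have : `|q| * `|u.2| <= b / 2 * 1 by apply: ler_pM.
  lra.
rewrite [X in `|X|](_ : _ = q * u.1); last by field; exact: un0.
rewrite normrM.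
have : `|q| * `|u.1| <= b / 2 * 1 by apply: ler_pM.
lra.
Qed.

Lemma rectangle_swap c u a b :
  flip @^-1` rectangle c u a b =
  rectangle (c.2, c.1) (u.2, u.1) a b.
Proof.
apply/seteqP; split => z /=; rewrite /rectangle/= => -[h1 h2]; split.
- by rewrite addrC.
- by rewrite -normrN opprB.
- by rewrite addrC.
- by rewrite -normrN opprB.
Qed.

Lemma measurable_rectangle c u a b : measurable (rectangle c u a b : set (R * R)).
Proof.
have m1 : measurable_fun setT (fun z : R * R => z.1) by exact: measurable_fst.
have m2 : measurable_fun setT (fun z : R * R => z.2) by exact: measurable_snd.
pose f (z : R * R) := (z.1 - c.1) * u.1 + (z.2 - c.2) * u.2.
pose g (z : R * R) := (z.2 - c.2) * u.1 - (z.1 - c.1) * u.2.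
have mf : measurable_fun setT f.
  by apply: measurable_funD; apply: measurable_funM => //; exact: measurable_funB.
have mg : measurable_fun setT g.
  by apply: measurable_funB; apply: measurable_funM => //; exact: measurable_funB.
rewrite (_ : rectangle c u a b = f @^-1` `[- a, a]%classic `&` g @^-1` `[- b, b]%classic).
  apply: measurableI; rewrite -[X in measurable X]setTI.
  - exact: mf.
  - exact: mg.
by apply/seteqP; split => z; rewrite /rectangle/= !in_itv/= !ler_norml.
Qed.

Lemma leb2_rectangle_swap c u a b :
  leb2 (rectangle c u a b) = leb2 (rectangle (c.2, c.1) (u.2, u.1) a b).
Proof. by rewrite -rectangle_swap leb2_swap//; exact: measurable_rectangle. Qed.

(** The rectangle is squeezed between two parallelograms. The exact area is [4 * (a * b)], but these
    bounds suffice and avoid rotation invariance. *)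
Lemma leb2_rectangle_bounds c u a b : u.1 ^+ 2 + u.2 ^+ 2 = 1 ->
  0 < b -> b <= a ->
  ((a * b / 2)%:E <= leb2 (rectangle c u a b) <= (16 * (a * b))%:E)%E.
Proof.
move=> u1 b0 ba; wlog u21 : c u u1 / `|u.2| <= `|u.1|.
  move=> H; have [|/ltW] := leP `|u.2| `|u.1|; first exact: H.
  by move=> h; rewrite leb2_rectangle_swap; apply: H => //=; rewrite addrC.
apply/andP; split.
  have -> : ((a * b / 2)%:E = leb2 (pset (Para c.1 c.2 (u.2 / u.1) (a / 4) (b / 2)) : set (plane R)))%E.
    by rewrite leb2_pset/=; [congr EFin; lra|lra|lra].
  apply: le_measure; rewrite ?inE; [| |exact: pset_sub_rectangle].
  - by apply: borel_plane; exact: measurable_pset.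
  - by apply: borel_plane; exact: measurable_rectangle.
have -> : ((16 * (a * b))%:E = leb2 (pset (Para c.1 c.2 (u.2 / u.1) (2 * a) (2 * b)) : set (plane R)))%E.
  by rewrite leb2_pset/=; [congr EFin; lra|lra|lra].
apply: le_measure; rewrite ?inE; [| |exact: rectangle_sub_pset].
- by apply: borel_plane; exact: measurable_rectangle.
- by apply: borel_plane; exact: measurable_pset.
Qed.

(** The sizes [4 * N * q4] and [8 * q4] leave room for rounding centre, slope and size to rationals.
    Inadmissible parameters give a fixed tile, so every index names an admissible one. *)
Definition rat_para N (q : rat * rat * rat * rat) : para :=
  let: (q1, q2, q3, q4) := q in
  if (`|ratr q3| <= 2 :> R) && (0 < ratr q4 :> R)
  then Para (ratr q1) (ratr q2) (ratr q3) (4 * N * ratr q4) (8 * ratr q4)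
  else Para 0 0 0 (4 * N) 8.

Definition rat_tile N (i : nat) : para :=
  rat_para N (odflt (0, 0, 0, 0) (unpickle i)).

Lemma wide_rat_tile N i : 2 <= N -> wide_para N (rat_tile N i).
Proof.
move=> N2; rewrite /rat_tile; case: (odflt _ _) => [[[q1 q2] q3] q4] /=.
case: ifPn => [/andP[h3 h4]|_]; split => //=; try lra.
- by rewrite -mulrA; have : 2 * ratr q4 <= N * ratr q4 :> R by [rewrite ler_pM2r]; lra.
- have : 0 < N * ratr q4 :> R by rewrite mulr_gt0//; lra.
  lra.
- by rewrite normr0.
Qed.

Lemma leb2_rat_tile_lty N i : 2 <= N ->
  (leb2 (pset (rat_tile N i) : set (plane R)) < +oo)%E.
Proof.
move=> N2; have [_ b0 ba _] := wide_rat_tile i N2.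
rewrite leb2_pset; [exact: ltry|exact: le_trans (ltW b0) ba|exact: ltW].
Qed.

Lemma rat_approx (x e : R) : 0 < e -> exists q : rat, `|x - ratr q| <= e.
Proof.
move=> e0; have /rat_in_itvoo[q] : x - e < x + e by lra.
rewrite in_itv/= => /andP[h1 h2]; exists q.
by rewrite ler_distlC ltW//= ltW.
Qed.

Lemma rectangle_sub_rat_tile N c u s : 2 <= N -> u.1 ^+ 2 + u.2 ^+ 2 = 1 ->
  `|u.2| <= `|u.1| -> 0 < s ->
  exists i, rectangle c u (N * s) s `<=` pset (rat_tile N i) /\
    4 * (plen (rat_tile N i) * pwid (rat_tile N i)) <= 512 * (N * s ^+ 2).
Proof.
move=> N2 u1 u21 s0.
have N0 : 0 < N by lra.
have [q1 h1] := rat_approx c.1 s0.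
have [q2 h2] := rat_approx c.2 s0.
(* Over the half-length [2 * (N * s)] a slope error of [N^-1] displaces the axis by at most
   [2 * s]. *)
have [q3 h3] : exists q : rat, `|u.2 / u.1 - ratr q| <= N^-1.
  by apply: rat_approx; rewrite invr_gt0.
have [q4] : exists q : rat, ratr q \in `]s, 2 * s[.
  by apply: rat_in_itvoo; lra.
rewrite in_itv/= => /andP[h4 h4'].
have un0 : u.1 != 0.
  apply/eqP => h; rewrite h normr0 normr_le0 in u21; move/eqP in u21.
  by move: u1; rewrite h u21 !expr0n/= addr0 => /eqP; rewrite eq_sym oner_eq0.
have m1 : `|u.2 / u.1| <= 1.
  by rewrite normrM normfV ler_pdivrMr ?normr_gt0// mul1r.
have Ni : N^-1 <= 1 by rewrite invf_le1//; lra.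
have m2 : `|ratr q3| <= 2 :> R.
  rewrite -[ratr q3](subKr (u.2 / u.1)); apply: (le_trans (ler_normB _ _)); lra.
exists (pickle (q1, q2, q3, q4)).
have -> : rat_tile N (pickle (q1, q2, q3, q4)) =
    Para (ratr q1) (ratr q2) (ratr q3) (4 * N * ratr q4) (8 * ratr q4).
  rewrite /rat_tile pickleK /= m2/=.
  by have -> : 0 < ratr q4 :> R by lra.
split => /=; last first.
  have : ratr q4 ^+ 2 <= (2 * s) ^+ 2 by rewrite lerXn2r ?nnegrE; lra.
  move=> hq; have : N * ratr q4 ^+ 2 <= N * (2 * s) ^+ 2 by rewrite ler_pM2l.
  lra.
have Ns : s <= N * s by rewrite ler_peMl//; lra.
move=> z /(rectangle_sub_pset u1 u21 s0 Ns)[]; rewrite /pline/= => z1 z2.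
have Nq : N * s <= N * ratr q4 by rewrite ler_pM2l// ltW.
split => /=.
  rewrite (_ : z.1 - _ = (z.1 - c.1) + (c.1 - ratr q1)); last by ring.
  apply: (le_trans (ler_normD _ _)); lra.
rewrite /pline/= (_ : z.2 - _ = (z.2 - (c.2 + u.2 / u.1 * (z.1 - c.1))) + (c.2 - ratr q2)
   + (u.2 / u.1 - ratr q3) * (z.1 - c.1) - ratr q3 * (c.1 - ratr q1)); last by ring.
apply: (le_trans (ler_normB _ _)).
(* In order: the enclosing parallelogram, then the rounding of the height of the centre, of the
   slope, and of the abscissa of the centre. The total [7 * s] is below [8 * ratr q4]. *)
apply: (@le_trans _ _ (2 * s + s + 2 * s + 2 * s)); last lra.
rewrite lerD//; last by rewrite normrM ler_pM.
apply: (le_trans (ler_normD _ _)); rewrite lerD//.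
  by apply: (le_trans (ler_normD _ _)); rewrite lerD.
rewrite normrM; apply: (@le_trans _ _ (N^-1 * (2 * (N * s)))); first exact: ler_pM.
by rewrite mulrCA mulKf// gt_eqF.
Qed.

Lemma swap_dilated_tiles N J : 5 * N <= 2 ^+ J ->
  dilated_tiles (@leb2 R)
    (fun P => flip @^-1` pset P : set (plane R))
    plen pdil (wide_para N) J 968.
Proof.
move=> NJ; have DT := pset_dilated_tiles NJ.
have E P : leb2 (flip @^-1` pset P : set (plane R)) =
    leb2 (pset P : set (plane R)).
  by rewrite leb2_swap//; exact: measurable_pset.
split.
- by move=> P _; apply: borel_plane; apply: measurable_swap_preimage; exact: measurable_pset.
- move=> P DP; rewrite [X in (_ < X)%E]E; exact: (tile_gt0 DT).
- move=> P DP; rewrite [X in (X < _)%E]E; exact: (tile_lty DT).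
- exact: (tile_dil DT).
- by move=> j P DP z; exact: (tile_sub_dil DT).
move=> P Q DP DQ PQ.
have EI : leb2 (flip @^-1` pset P `&`
   flip @^-1` pset Q : set (plane R)) =
    leb2 (pset P `&` pset Q : set (plane R)).
  by rewrite -preimage_setI leb2_swap//; apply: measurableI; exact: measurable_pset.
have [h|[j jJ [sub h]]] := tile_overlap DT DP DQ PQ.
  by left; rewrite -[RHS]h; congr fine; exact: EI.
right; exists j => //; split; first by move=> z /=; exact: sub.
rewrite [X in fine X * _ <= _]EI [X in _ * fine X <= _]E.
by rewrite [X in _ <= _ * (fine X * _)]E [X in _ <= _ * (_ * fine X)]E.
Qed.

End rectangle_geometry.

(** * The Kakeya maximal operator on L^2 *)

Section integral_norm.
Context d (T : measurableType d) (R : realType) (mu : {measure set T -> \bar R}).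

Lemma measurable_abse_EFin (S : set T) (f : T -> R) : measurable_fun setT f ->
  measurable_fun S (fun y => `|(f y)%:E|%E).
Proof.
move=> mf; apply: measurableT_comp => //; apply/measurable_EFinP.
exact: measurable_funTS.
Qed.

Lemma subset_integral_norm (A B : set T) (f : T -> R) : measurable A -> measurable B ->
  measurable_fun setT f -> A `<=` B ->
  (\int[mu]_(y in A) `|(f y)%:E| <= \int[mu]_(y in B) `|(f y)%:E|)%E.
Proof.
by move=> mA mB mf AB; apply: ge0_subset_integral => //; exact: measurable_abse_EFin.
Qed.

End integral_norm.

(** * Measurability of the maximal function *)

Section kakeya_basic.
Context {R : realType}.
Implicit Types (c u : R * R) (s a b N : R) (f g : plane R -> R).

(** An open set is the union of the countably many rational boxes that it contains. The link is
    needed because the measurable sets of [plane] come from an outer measure and not from a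
    topology. *)
Lemma measurable_of_boxes (A : set (plane R)) :
  (forall x, A x -> exists2 e, 0 < e &
     forall y : plane R, `|y.1 - x.1| < e -> `|y.2 - x.2| < e -> A y) ->
  measurable A.
Proof.
move=> hA.
pose box (q : rat * rat * rat) : set (plane R) :=
  [set y | `|y.1 - ratr q.1.1| < ratr q.2] `&` [set y | `|y.2 - ratr q.1.2| < ratr q.2].
pose F (i : nat) : set (plane R) :=
  if unpickle i is Some q then (if `[< box q `<=` A >] then box q else set0) else set0.
have -> : A = \bigcup_i F i.
  apply/seteqP; split => [x Ax|x [i _]]; last first.
    rewrite /F; case: (unpickle i) => // q; case: asboolP => //.
    by move=> qA /qA.
  have [e e0 he] := hA _ Ax.
  (* With the centre within [e / 4] of [x], such a radius makes the box contain [x] and stay within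
     distance [e] of it. *)
  have [r] : exists r : rat, ratr r \in `](e / 4), (e / 2)[.
    by apply: rat_in_itvoo; lra.
  rewrite in_itv/= => /andP[r1 r2].
  have e4 : 0 < e / 4 by lra.
  have [q1 h1] := rat_approx x.1 e4.
  have [q2 h2] := rat_approx x.2 e4.
  have [i iE] : exists i, unpickle i = Some (q1, q2, r).
    by exists (pickle (q1, q2, r)); rewrite pickleK.
  exists i; first by [].
  rewrite /F iE.
  case: asboolP => [_|]; first by split => /=; exact: (le_lt_trans _ r1).
  move=> []; move=> y [/= y1 y2]; apply: he.
  - rewrite (_ : y.1 - x.1 = (y.1 - ratr q1) - (x.1 - ratr q1)); last by ring.
    by apply: (le_lt_trans (ler_normB _ _)); lra.
  - rewrite (_ : y.2 - x.2 = (y.2 - ratr q2) - (x.2 - ratr q2)); last by ring.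
    by apply: (le_lt_trans (ler_normB _ _)); lra.
apply: bigcup_measurable => i _; rewrite /F; case: (unpickle i) => // q.
case: asboolP => // _; apply: measurableI.
- rewrite (_ : mkset _ = [set: plane R] `&` (fun y : plane R => y.1) @^-1`
      `](ratr q.1.1 - ratr q.2), (ratr q.1.1 + ratr q.2)[%classic).
    exact: measurable_plane_fst.
  by rewrite setTI; apply/seteqP; split => y /=; rewrite in_itv/= ltr_distl.
- rewrite (_ : mkset _ = [set: plane R] `&` (fun y : plane R => y.2) @^-1`
      `](ratr q.1.2 - ratr q.2), (ratr q.1.2 + ratr q.2)[%classic).
    exact: measurable_plane_snd.
  by rewrite setTI; apply/seteqP; split => y /=; rewrite in_itv/= ltr_distl.
Qed.

Lemma rectangles_measurable N (S : set (plane R)) : rectangles N S -> measurable S.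
Proof. by move=> [c [u [s [_ _ ->]]]]; apply: borel_plane; exact: measurable_rectangle. Qed.

Lemma rectangles_fin N (S : set (plane R)) : 1 <= N -> rectangles N S ->
  (0 < leb2 S < +oo)%E.
Proof.
move=> N1 [c [u [s [u1 s0 ->]]]].
have sN : s <= N * s by rewrite ler_peMl// ltW.
have /andP[h1 h2] := leb2_rectangle_bounds c u1 s0 sN.
rewrite (lt_le_trans _ h1) ?(le_lt_trans h2) ?ltry// lte_fin.
by rewrite !mulr_gt0//; lra.
Qed.

Lemma averageE N f (S : set (plane R)) : 1 <= N -> rectangles N S ->
  average f S = ((fine (leb2 S))^-1%:E * \int[leb2]_(y in S) `|(f y)%:E|)%E.
Proof.
move=> N1 RS; have /andP[h1 h2] := rectangles_fin N1 RS.
rewrite /average -[in LHS](@fineK _ (leb2 S)) ?ge0_fin_numE// ?(ltW h1)//.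
by rewrite inver gt_eqF// fine_gt0// h1.
Qed.

Lemma average_ge0 f (S : set (plane R)) : (0 <= average f S)%E.
Proof.
by rewrite /average mule_ge0// ?integral_ge0// inve_ge0 measure_ge0.
Qed.

Lemma average_le_kakeya N f (S : set (plane R)) x : rectangles N S -> S x ->
  (average f S <= kakeya N f x)%E.
Proof. by move=> RS Sx; apply: ereal_sup_ubound; exists S. Qed.

Lemma kakeya_ge0 N f x : 1 <= N -> (0 <= kakeya N f x)%E.
Proof.
move=> N1; apply: (@le_trans _ _ (average f (rectangle x (1, 0) (N * 1) 1))).
  exact: average_ge0.
apply: average_le_kakeya.
  by exists x, (1, 0), 1; split => //=; rewrite expr1n expr0n addr0.
by split => /=; rewrite !subrr !mul0r ?subr0 ?addr0 normr0//; lra.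
Qed.

Lemma le_rectangle c u a b a' b' : a <= a' -> b <= b' ->
  rectangle c u a b `<=` rectangle c u a' b'.
Proof. by move=> aa bb z [z1 z2]; split; [exact: le_trans z1 aa|exact: le_trans z2 bb]. Qed.

(** Continuity from above: the closed rectangle is the intersection of its enlargements, which have
    finite measure. *)
Lemma leb2_dilated_rectangle_cvg N c u s : 1 <= N -> u.1 ^+ 2 + u.2 ^+ 2 = 1 -> 0 < s ->
  leb2 (rectangle c u (N * (s + s / n.+1%:R)) (s + s / n.+1%:R)) @[n --> \oo] -->
  leb2 (rectangle c u (N * s) s).
Proof.
move=> N1 u1 s0; pose F n := rectangle c u (N * (s + s / n.+1%:R)) (s + s / n.+1%:R).
have N0 : 0 < N by lra.
have sn n : 0 < s / n.+1%:R by rewrite divr_gt0// ltr0n.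
have rE : rectangle c u (N * s) s = \bigcap_n F n.
  apply/seteqP; split => [z Sz n _|z Fz].
    apply: le_rectangle Sz; last by rewrite lerDl ltW.
    by rewrite ler_pM2l// lerDl ltW.
  have lim (x k : R) : 0 < k -> (forall n, x <= k * (s + s / n.+1%:R)) -> x <= k * s.
    move=> k0 h; apply/ler_addgt0Pr => e e0.
    pose n := `|Num.ceil (k * s / e)|%N.
    apply: (le_trans (h n)); rewrite mulrDr lerD2l mulrA ler_pdivrMr ?ltr0n//.
    rewrite [leRHS]mulrC -ler_pdivrMr//.
    have h1 : k * s / e <= (Num.ceil (k * s / e))%:~R by exact: Num.Theory.ceil_ge.
    apply: (le_trans h1); apply: (@le_trans _ _ n%:R); last by rewrite ler_nat.
    by rewrite /n natr_absz ler_int ler_norm.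
  split.
    by apply: lim => // n; have [] := Fz n Logic.I.
  by rewrite -[s]mul1r; apply: lim => // n; rewrite mul1r; have [] := Fz n Logic.I.
rewrite rE; apply: (@nonincreasing_cvg_mu _ _ _ (@leb2 R) F).
- have sN : s + s / 1%:R <= N * (s + s / 1%:R) by rewrite ler_peMl//; have := sn 0%N; lra.
  have sp : 0 < s + s / 1%:R by have := sn 0%N; lra.
  by have /andP[_ h] := leb2_rectangle_bounds c u1 sp sN; exact: (le_lt_trans h (ltry _)).
- by move=> n; apply: borel_plane; exact: measurable_rectangle.
- by apply: bigcapT_measurable => n; apply: borel_plane; exact: measurable_rectangle.
- move=> p q pq; apply/subsetPset; apply: le_rectangle.
    rewrite ler_pM2l// lerD2l ler_pM2l// lef_pV2 ?posrE ?ltr0n// ler_nat//.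
  by rewrite lerD2l ler_pM2l// lef_pV2 ?posrE ?ltr0n// ler_nat.
Qed.

(** Superlevel sets are open. If the average over [S] exceeds [r], so does the average over a slight
    enlargement of [S] of the same eccentricity, and this enlargement contains a neighbourhood of
    each point of [S]. *)
Lemma measurable_kakeya N f : 1 <= N -> measurable_fun setT f ->
  measurable_fun setT (kakeya N f).
Proof.
move=> N1 mf; apply: (measurability _ (ErealGenOInfty.measurableE R)).
move=> _ [_ [r ->] <-]; rewrite setTI.
apply: measurable_of_boxes => x /=; rewrite in_itv/= andbT.
move=> /ereal_sup_gt[_ [S [RS Sx] <-]].
have /andP[L0 Loo] := rectangles_fin N1 RS.
have mS := rectangles_measurable RS.
rewrite (averageE f N1 RS); have [c [u [s [u1 s0 SE]]]] := RS.
set I := (\int[leb2]_(y in S) `|(f y)%:E|)%E => rI.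
have I0 : (0 <= I)%E by exact: integral_ge0.
have sn n : 0 < s / n.+1%:R by rewrite divr_gt0// ltr0n.
pose F n := rectangle c u (N * (s + s / n.+1%:R)) (s + s / n.+1%:R).
have RF n : rectangles N (F n).
  by exists c, u, (s + s / n.+1%:R); split => //; rewrite addr_gt0.
have SF n : S `<=` F n.
  rewrite SE; apply: le_rectangle; last by rewrite lerDl ltW.
  by rewrite ler_pM2l ?lerDl ?ltW//; lra.
have [n rn] : exists n, (r%:E < (fine (leb2 (F n)))^-1%:E * I)%E.
  have [IE|Ifin] := eqVneq I +oo%E.
    exists 0%N; rewrite IE gt0_muley ?ltry// lte_fin invr_gt0 fine_gt0//.
    exact: (rectangles_fin N1 (RF 0%N)).
  have fI : I \is a fin_num by rewrite ge0_fin_numE// ltey.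
  have cF : fine (leb2 (F n)) @[n --> \oo] --> fine (leb2 S).
    apply: fine_cvg; rewrite fineK ?ge0_fin_numE// SE.
    exact: leb2_dilated_rectangle_cvg.
  have fS0 : 0 < fine (leb2 S) by rewrite fine_gt0// L0.
  have crF : r * fine (leb2 (F n)) @[n --> \oo] --> r * fine (leb2 S) by apply: cvgM cF; exact: cvg_cst.
  have rSI : r * fine (leb2 S) < fine I.
    by move: rI; rewrite -(fineK fI) -EFinM lte_fin mulrC ltr_pdivlMr.
  have [n _ hn] := cvgr_lt _ crF _ rSI.
  exists n; have := hn n (leqnn n) => /= h.
  have Fn0 : 0 < fine (leb2 (F n)) by rewrite fine_gt0// (rectangles_fin N1 (RF n)).
  by rewrite -(fineK fI) -EFinM lte_fin mulrC ltr_pdivlMr.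
exists ((s / n.+1%:R) / 2); first by rewrite divr_gt0.
move=> y y1 y2; rewrite in_itv/= andbT.
apply: (lt_le_trans rn); apply: (@le_trans _ _ (average f (F n))).
  rewrite (averageE f N1 (RF n)); apply: lee_wpmul2l.
    by rewrite lee_fin invr_ge0 fine_ge0.
  exact: (subset_integral_norm _ mS (rectangles_measurable (RF n)) mf (SF n)).
apply: average_le_kakeya => //.
move: Sx; rewrite SE => -[x1 x2].
have [k1 k2] := unit_vector_le1 u1.
have a1 : `|(y.1 - x.1) * u.1| <= (s / n.+1%:R) / 2.
  by rewrite normrM -[leRHS]mulr1 ler_pM// ltW.
have a2 : `|(y.1 - x.1) * u.2| <= (s / n.+1%:R) / 2.
  by rewrite normrM -[leRHS]mulr1 ler_pM// ltW.
have b1 : `|(y.2 - x.2) * u.1| <= (s / n.+1%:R) / 2.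
  by rewrite normrM -[leRHS]mulr1 ler_pM// ltW.
have b2 : `|(y.2 - x.2) * u.2| <= (s / n.+1%:R) / 2.
  by rewrite normrM -[leRHS]mulr1 ler_pM// ltW.
have snN : s / n.+1%:R <= N * (s / n.+1%:R) by rewrite ler_peMl// ltW.
move: a1 a2 b1 b2 snN; rewrite /F; set e := s / n.+1%:R; set Ne := N * e.
move=> a1 a2 b1 b2 snN; split.
  rewrite [X in `|X|](_ : _ = ((x.1 - c.1) * u.1 + (x.2 - c.2) * u.2) +
    ((y.1 - x.1) * u.1 + (y.2 - x.2) * u.2)); last by ring.
  apply: (le_trans (ler_normD _ _)); rewrite mulrDr -/Ne lerD//.
  by apply: (le_trans (ler_normD _ _)); lra.
rewrite [X in `|X|](_ : _ = ((x.2 - c.2) * u.1 - (x.1 - c.1) * u.2) +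
    ((y.2 - x.2) * u.1 - (y.1 - x.1) * u.2)); last by ring.
apply: (le_trans (ler_normD _ _)); rewrite lerD//.
by apply: (le_trans (ler_normB _ _)); lra.
Qed.

End kakeya_basic.

Section ereal_powers.
Context {R : realType}.
Implicit Types (x y : \bar R) (r : R).

Lemma le_poweR x y r : 0 <= r -> (0 <= x)%E -> (x <= y)%E -> (x `^ r <= y `^ r)%E.
Proof.
move=> r0 x0 xy; apply: gt0_ler_poweR => //; rewrite in_itv/= leey andbT//.
exact: le_trans xy.
Qed.

Lemma poweRVK x r : r != 0 -> (0 <= x)%E -> ((x `^ r) `^ r^-1)%E = x.
Proof. by move=> r0 x0; rewrite -poweRrM mulfV// poweRe1. Qed.

Lemma poweRKV x r : r != 0 -> (0 <= x)%E -> ((x `^ r^-1) `^ r)%E = x.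
Proof. by move=> r0 x0; rewrite -poweRrM mulVf// poweRe1. Qed.

(** Moves a power inside a supremum by bounding each element by the root of [B]; used to estimate
    powers of [kakeya] one rectangle at a time. *)
Lemma ereal_sup_poweR_le (S : set (\bar R)) r B : 0 < r -> (0 <= B)%E ->
  (0 <= ereal_sup S)%E -> (forall x, S x -> (0 <= x)%E /\ (x `^ r <= B)%E) ->
  (ereal_sup S `^ r <= B)%E.
Proof.
move=> r0 B0 S0 h.
have rn0 : r != 0 by rewrite gt_eqF.
have : (ereal_sup S <= B `^ r^-1)%E.
  apply: ge_ereal_sup => x Sx; have [x0 xB] := h _ Sx.
  by rewrite -(poweRVK rn0 x0); apply: le_poweR => //; [rewrite invr_ge0 ltW|exact: poweR_ge0].
by move/(le_poweR (ltW r0) S0); rewrite poweRKV.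
Qed.

End ereal_powers.

Section integral_two.
Context d (T : measurableType d) (R : realType) (mu : {measure set T -> \bar R}).

Lemma integral_le_twice (F G H : T -> \bar R) (k : R) (B : \bar R) : 0 <= k ->
  (forall x, 0 <= F x)%E -> (forall x, 0 <= G x)%E -> (forall x, 0 <= H x)%E ->
  measurable_fun setT F -> measurable_fun setT G -> measurable_fun setT H ->
  (forall x, F x <= k%:E * (G x + H x))%E ->
  (\int[mu]_x G x <= B)%E -> (\int[mu]_x H x <= B)%E ->
  (\int[mu]_x F x <= k%:E * (B + B))%E.
Proof.
move=> k0 F0 G0 H0 mF mG mH FGH GB HB.
have mGH : measurable_fun setT (fun x => G x + H x)%E by exact: emeasurable_funD.
have GH0 x : (0 <= G x + H x)%E by exact: adde_ge0.
apply: (@le_trans _ _ (\int[mu]_x (k%:E * (G x + H x)))%E).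
  apply: ge0_le_integral => //; exact: emeasurable_funM.
rewrite ge0_integralZl_EFin// ge0_integralD//.
by apply: lee_wpmul2l; [rewrite lee_fin|exact: leeD].
Qed.

Lemma measurable_poweR_comp (F : T -> \bar R) (r : R) : measurable_fun setT F ->
  measurable_fun setT (fun x => F x `^ r)%E.
Proof. by move=> mF; exact: (measurableT_comp (measurable_poweR r)). Qed.

End integral_two.

(** * The L^2 bound with logarithmic growth *)

Section kakeya_L2.
Context {R : realType}.
Local Notation flip := (fun x : R * R => (x.2, x.1)).
Implicit Types (c u : R * R) (s a b N : R) (f g : plane R -> R).

Lemma average_le_mean N (S P : set (plane R)) f k : 1 <= N -> rectangles N S ->
  measurable P -> S `<=` P -> (leb2 P < +oo)%E -> measurable_fun setT f ->
  (\int[leb2]_(y in P) `|(f y)%:E| < +oo)%E ->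
  fine (leb2 P) <= k * fine (leb2 S) ->
  (average f S <= (k * mean leb2 (fun y => `|f y|%R) P)%:E)%E.
Proof.
move=> N1 RS mP SP fP mf fI hk; rewrite (averageE f N1 RS).
have mS := rectangles_measurable RS; have /andP[S0 Soo] := rectangles_fin N1 RS.
have I0 : (0 <= \int[leb2]_(y in P) `|(f y)%:E|)%E by exact: integral_ge0.
have LS : 0 < fine (leb2 S) by rewrite fine_gt0// S0.
have LP : 0 < fine (leb2 P).
  by apply: lt_le_trans LS _; apply: le_fine_measure.
apply: (@le_trans _ _ ((fine (leb2 S))^-1%:E * \int[leb2]_(y in P) `|(f y)%:E|)%E).
  apply: lee_wpmul2l; first by rewrite lee_fin invr_ge0 ltW.
  exact: subset_integral_norm.
rewrite /mean -[X in (_ * X)%E]fineK ?ge0_fin_numE// -EFinM lee_fin [leRHS]mulrCA [leLHS]mulrC.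
apply: ler_wpM2l; first exact: fine_ge0.
by rewrite ler_pdivlMr// mulrC ler_pdivrMr.
Qed.

(** Two countable families of tiles: [hmaximal] controls the rectangles with long axis nearer to the
    horizontal, [vmaximal] the steep ones through reflected tiles. *)
Definition vmaximal N f := sqr_maximal (@leb2 R)
  (fun P => flip @^-1` pset P : set (plane R)) (rat_tile N) f.
Definition hmaximal N f := sqr_maximal (@leb2 R)
  (fun P => pset P : set (plane R)) (rat_tile N) f.

(** 1024 is 512, from the area of the tile, divided by the 1 / 2 of [leb2_rectangle_bounds]. *)
Lemma leb2_rat_tile_le N c u s i : 2 <= N -> u.1 ^+ 2 + u.2 ^+ 2 = 1 -> 0 < s ->
  4 * (plen (rat_tile N i) * pwid (rat_tile N i)) <= 512 * (N * s ^+ 2) ->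
  fine (leb2 (pset (rat_tile N i) : set (plane R))) <=
    1024 * fine (leb2 (rectangle c u (N * s) s)).
Proof.
move=> N2 u1 s0 h; have [_ b0 ba _] := wide_rat_tile i N2.
rewrite leb2_pset /=; [|lra|lra].
have sN : s <= N * s by rewrite ler_peMl//; lra.
have /andP[h1 h2] := leb2_rectangle_bounds c u1 s0 sN.
have : N * s * s / 2 <= fine (leb2 (rectangle c u (N * s) s)).
  by rewrite -lee_fin fineK// ge0_fin_numE// (le_lt_trans h2)// ltry.
lra.
Qed.

Lemma average_sqr_le N k f (S : set (plane R)) x : 2 <= N -> 1024 <= k -> measurable_fun setT f ->
  (\int[leb2]_y (`|f y|%R ^+ 2)%:E < +oo)%E -> rectangles N S -> S x ->
  (average f S `^ 2 <= (k ^+ 2)%:E *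
     (hmaximal N (fun y => `|f y|%R) x + vmaximal N (fun y => `|f y|%R) x))%E.
Proof.
move=> N2 k1 mf f2 RS Sx; have N1 : 1 <= N by lra.
have k0 : 0 <= k by lra.
have hk (r : R) : r <= 1024 * fine (leb2 S) -> r <= k * fine (leb2 S).
  by move=> h; apply: (le_trans h); apply: ler_wpM2r => //; exact: fine_ge0.
have mnf : measurable_fun setT (fun y => `|f y|%R) by exact: measurableT_comp.
have fin (P : set (plane R)) : measurable P -> (leb2 P < +oo)%E ->
    (\int[leb2]_(y in P) `|(f y)%:E| < +oo)%E.
  by move=> mP fP; exact: (integral_lty_sqr mP fP _ mnf f2).
have fold (P : set (plane R)) (M : \bar R) : measurable P -> (leb2 P < +oo)%E -> S `<=` P ->
    fine (leb2 P) <= k * fine (leb2 S) ->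
    ((mean leb2 (fun y => `|f y|%R) P ^+ 2)%:E <= M)%E ->
    (average f S `^ 2 <= (k ^+ 2)%:E * M)%E.
  move=> mP fP SP hP hM.
  have := average_le_mean N1 RS mP SP fP mf (fin _ mP fP) hP.
  have r2 : 0 <= 2 :> R by [].
  move=> /(le_poweR r2 (average_ge0 f S)) h; apply: (le_trans h).
  rewrite poweR_EFin powR_mulrn; last by rewrite mulr_ge0// mean_ge0.
  by rewrite exprMn EFinM; apply: lee_wpmul2l => //; rewrite lee_fin sqr_ge0.
have mh0 := sqr_maximal_ge0.
have [c [u [s [u1 s0 SE]]]] := RS.
have [u21|/ltW u12] := leP `|u.2| `|u.1|.
  have [i [sub hi]] := rectangle_sub_rat_tile c N2 u1 u21 s0.
  apply: (fold (pset (rat_tile N i))).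
  - by apply: borel_plane; exact: measurable_pset.
  - exact: leb2_rat_tile_lty.
  - by rewrite SE.
  - by apply: hk => //; rewrite SE; exact: leb2_rat_tile_le.
  apply: (@le_trans _ _ (hmaximal N (fun y => `|f y|%R) x)); last first.
    by rewrite leeDl// mh0.
  apply: (@sqr_maximal_ge _ _ _ (@leb2 R) _ (fun P => pset P : set (plane R))).
  by apply: sub; rewrite -SE.
have u1' : (u.2, u.1).1 ^+ 2 + (u.2, u.1).2 ^+ 2 = 1 by rewrite addrC.
have [i [sub hi]] := rectangle_sub_rat_tile (c.2, c.1) N2 u1' u12 s0.
have sub' : S `<=` flip @^-1` pset (rat_tile N i).
  move=> z; rewrite SE => Sz; apply: sub; rewrite -rectangle_swap.
  by case: z Sz.
have E : leb2 (flip @^-1` pset (rat_tile N i) : set (plane R)) =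
    leb2 (pset (rat_tile N i) : set (plane R)).
  by rewrite leb2_swap//; exact: measurable_pset.
apply: (fold (flip @^-1` pset (rat_tile N i))) => //.
- by apply: borel_plane; apply: measurable_swap_preimage; exact: measurable_pset.
- by rewrite E; exact: leb2_rat_tile_lty.
- by apply: hk => //; rewrite E SE; exact: leb2_rat_tile_le.
apply: (@le_trans _ _ (vmaximal N (fun y => `|f y|%R) x)); last first.
  by rewrite leeDr// mh0.
apply: (@sqr_maximal_ge _ _ _ (@leb2 R) _
  (fun P => flip @^-1` pset P : set (plane R))).
exact: sub'.
Qed.

Lemma expR1_le_facts (N : R) : expR 1 <= N -> [/\ 2 <= N, 1 < N, 0 < N & 1 <= ln N].
Proof.
move=> eN; have e2 : 2 <= expR (1 : R) by have := expR_ge1Dx (1 : R); lra.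
have N0 : 0 < N by lra.
by split => //; [lra|lra|rewrite -[leLHS]expRK ler_ln// posrE expR_gt0].
Qed.

(** As [expR 2^-1 <= 2], any [J] above [2 * ln (5 * N)] will do; [1 <= ln N] absorbs the additive
    constants. *)
Lemma dyadic_count : exists2 C : R, 0 < C & forall N, expR 1 <= N ->
  exists J : nat, 5 * N <= 2 ^+ J /\ J.+1%:R <= C * ln N.
Proof.
exists (2 * ln 5 + 4); first by have : 0 < ln (5 : R) by [rewrite ln_gt0//; lra]; lra.
move=> N /expR1_le_facts[N2 N1 N0 l1].
have l5 : 0 <= ln (5 : R) by rewrite ln_ge0//; lra.
have ge0 : 0 <= 2 * ln (5 * N).
  by rewrite mulr_ge0// ln_ge0//; lra.
have /andP[t1 t2] := Num.Theory.truncn_itv ge0.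
exists (Num.trunc (2 * ln (5 * N))).+1; split.
  rewrite -[leLHS]lnK ?posrE; last by lra.
  have e2 : expR (2^-1) <= 2 :> R.
    rewrite -[leLHS]invrK -expRN -[leRHS]invrK lef_pV2 ?posrE ?expR_gt0//.
    by have := expR_ge1Dx (- 2^-1 : R); lra.
  apply: (@le_trans _ _ (expR 2^-1 ^+ (Num.trunc (2 * ln (5 * N))).+1)).
    by rewrite -expRM_natr ler_expR; lra.
  by rewrite lerXn2r// nnegrE// expR_ge0.
rewrite -[X in X%:R <= _]addn2 natrD.
have : ln (5 * N) = ln 5 + ln N by rewrite lnM// posrE.
nra.
Qed.

Lemma kakeya_L2 : exists2 C : R, 0 < C & forall N f, expR 1 <= N ->
  measurable_fun setT f ->
  (\int[leb2]_x (kakeya N f x `^ 2) <=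
     (C * (ln N) ^+ 2)%:E * \int[leb2]_x (`|f x|%R ^+ 2)%:E)%E.
Proof.
have [C C0 hC] := dyadic_count.
have [k k1] : exists k : R, 1024 <= k by exists 1024.
have k0 : 0 < k by lra.
have [l [l0 l1]] : exists l : R, 0 < l /\ l = 968.
  by exists 968; split; [rewrite ltr0n|reflexivity].
exists (2 * (k * (2 * (l * C))) ^+ 2).
  by rewrite mulr_gt0// exprn_gt0// !mulr_gt0.
move=> N f eN mf; have [J [NJ JN]] := hC _ eN.
have [N2 /ltW N1 N0 lN] := expR1_le_facts eN.
have [f2|] := ltP (\int[leb2]_x (`|f x|%R ^+ 2)%:E)%E +oo%E; last first.
  rewrite leye_eq => /eqP ->; rewrite gt0_muley ?leey// lte_fin.
  by rewrite mulr_gt0 ?exprn_gt0 ?mulr_gt0//; lra.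
have mnf : measurable_fun setT (fun y => `|f y|%R) by exact: measurableT_comp.
have nf0 t : 0 <= `|f t| by [].
have wt i : wide_para N (rat_tile N i) by exact: wide_rat_tile.
have DH := pset_dilated_tiles NJ; have DV := swap_dilated_tiles NJ.
rewrite -l1 in DH DV.
have hH := integral_sqr_maximal_le DH l0 wt nf0 mnf.
have hV := integral_sqr_maximal_le DV l0 wt nf0 mnf.
have mH := measurable_sqr_maximal DH (fun y => `|f y|%R) wt.
have mV := measurable_sqr_maximal DV (fun y => `|f y|%R) wt.
have mK := measurable_poweR_comp 2 (measurable_kakeya N1 mf).
have K2 : 0 <= k ^+ 2 :> R by exact: sqr_ge0.
have K0 x : (0 <= kakeya N f x `^ 2)%E by exact: poweR_ge0.
have := integral_le_twice K2 K0 _ _ mK mH mV _ hH hV.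
move=> /(_ (sqr_maximal_ge0 _ _ _ _) (sqr_maximal_ge0 _ _ _ _)) h.
apply: (le_trans (h _)).
  move=> x; apply: ereal_sup_poweR_le => //.
  - by rewrite mule_ge0// adde_ge0//; exact: sqr_maximal_ge0.
  - exact: kakeya_ge0.
  move=> _ [S [RS Sx] <-]; split; first exact: average_ge0.
  exact: average_sqr_le.
set I := (\int[leb2]_x _)%E; have I0 : (0 <= I)%E.
  by apply: integral_ge0 => t _; rewrite lee_fin sqr_ge0.
rewrite -ge0_muleDl ?lee_fin ?sqr_ge0// muleA -EFinD -EFinM.
apply: lee_wpmul2r => //; rewrite lee_fin.
have : (2 * (l * J.+1%:R)) ^+ 2 <= (2 * (l * (C * ln N))) ^+ 2.
  have ab : 2 * (l * J.+1%:R) <= 2 * (l * (C * ln N)) by rewrite ler_pM2l// ler_pM2l.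
  have a0 : 0 <= 2 * (l * J.+1%:R) by rewrite !mulr_ge0// ltW.
  by apply: lerXn2r; rewrite ?nnegrE// (le_trans a0).
move=> hh; apply: (@le_trans _ _ (k ^+ 2 * ((2 * (l * (C * ln N))) ^+ 2 + (2 * (l * (C * ln N))) ^+ 2))).
  by apply: ler_wpM2l => //; apply: lerD.
by rewrite le_eqVlt; apply/orP; left; apply/eqP; ring.
Qed.

End kakeya_L2.

(** * Variable exponents *)

Section measurable_power.
Context d (T : measurableType d) (R : realType).

Lemma measurable_powR_fun (f p : T -> R) : measurable_fun setT f ->
  measurable_fun setT p -> measurable_fun setT (fun x => f x `^ p x).
Proof.
move=> mf mp; rewrite /powR.
apply: measurable_fun_ifT.
- exact: measurable_fun_eqr.
- rewrite (_ : (fun x => _) = (fun x => if p x == 0 then 1 else 0 : R)).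
    apply: measurable_fun_ifT => //; exact: measurable_fun_eqr.
  by apply/funext => x; case: (p x == 0).
- apply: measurableT_comp; first exact: measurable_expR.
  apply: measurable_funM => //; apply: measurableT_comp => //.
Qed.

Lemma measurable_poweR_fun (F : T -> \bar R) (p : T -> R) : measurable_fun setT F ->
  measurable_fun setT p -> (forall x, 0 <= F x)%E -> (forall x, 0 < p x) ->
  measurable_fun setT (fun x => F x `^ p x)%E.
Proof.
move=> mF mp F0 p0.
rewrite (_ : (fun x => _) = (fun x => if F x == +oo then +oo else (fine (F x) `^ p x)%:E)%E).
  apply: measurable_fun_ifT => //; first exact: measurable_fun_eqe.
  apply/measurable_EFinP; apply: measurable_powR_fun => //.
  by apply: measurableT_comp => //.
apply/funext => x; case: ifPn => [/eqP ->|Fx]; first by rewrite poweRyr// gt_eqF.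
by rewrite -poweR_EFin fineK// ge0_fin_numE// ltey.
Qed.

End measurable_power.

Section power_inequalities.
Context {R : realType}.
Implicit Types t x tau th a b p q D : R.

(** Above [tau] the factor [(x / tau)]^ (th - 1)[is at least 1. The bound is affine in]x [^ th], so
    it can be averaged. *)
Lemma le_add_powR x tau th : 0 <= x -> 0 < tau -> 1 <= th ->
  x <= tau + tau `^ (1 - th) * x `^ th.
Proof.
move=> x0 t0 th1; have [h|h] := leP x tau.
  by apply: (le_trans h); rewrite lerDl mulr_ge0// powR_ge0.
have xp : 0 < x by apply: lt_trans h.
rewrite -[leLHS]add0r lerD//; first exact: ltW.
have -> : x `^ th = x * x `^ (th - 1) by rewrite mulr_powRB1//; lra.
rewrite mulrCA; apply: ler_peMr => //.
rewrite -(opprB th 1) powRN mulrC ler_pdivlMr ?powR_gt0//.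
rewrite mul1r; apply: ge0_ler_powR; rewrite ?nnegrE; [lra|exact: ltW|exact: ltW|exact: ltW].
Qed.

(* For [t >= D^-2] the change of exponent costs at most [D^(2|p-q|)], and for smaller [t] the left-hand side is at most [D^-4]. *)
Lemma powR_exponent_change t p q D k : 0 <= t -> t <= 1 -> 2 <= p -> 0 < q -> 1 < D ->
  `|p - q| * ln D <= k -> t `^ p <= expR (2 * k) * t `^ q + D ^- 4.
Proof.
move=> t0 t1 p2 q0 D1 hk; have D0 : 0 < D by lra.
have [->|tn] := eqVneq t 0.
  by rewrite !powR0 ?gt_eqF//; [rewrite mulr0 add0r invr_ge0 exprn_ge0// ltW|lra].
have tp : 0 < t by rewrite lt_neqAle eq_sym tn.
have [h|h] := leP (D ^- 2) t.
  rewrite ler_wpDr//; first by rewrite invr_ge0 exprn_ge0// ltW.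
  have -> : t `^ p = t `^ (p - q) * t `^ q.
    by rewrite -powRD ?subrK//; apply/implyP.
  apply: ler_wpM2r; first exact: powR_ge0.
  rewrite /powR gt_eqF// ler_expR.
  have l1 : - ln t <= 2 * ln D.
    have : ln (D ^- 2) <= ln t by rewrite ler_ln// posrE// invr_gt0 exprn_gt0.
    rewrite lnV ?posrE ?exprn_gt0// lnXn//; lra.
  have l0 : ln t <= 0 by rewrite ln_le0.
  apply: (@le_trans _ _ (`|p - q| * (- ln t))).
    have := ler_norm (- (p - q)); rewrite normrN; nra.
  have : 0 <= `|p - q| by [].
  have : 0 <= ln D by rewrite ln_ge0// ltW.
  nra.
rewrite ler_wpDl//; first by rewrite mulr_ge0 ?expR_ge0 ?powR_ge0.
apply: (@le_trans _ _ (t `^ 2)); first by apply: ger_powR; rewrite ?tp.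
rewrite powR_mulrn// (_ : D ^- 4 = (D ^- 2) ^+ 2); last by rewrite -exprVn -exprVn -exprM.
by rewrite lerXn2r// ?nnegrE// ltW// invr_gt0 exprn_gt0.
Qed.

End power_inequalities.

Section integral_means.
Context d (T : measurableType d) (R : realType) (mu : {measure set T -> \bar R}).
Implicit Types (f h : T -> R) (S : set T).

(** Jensen's inequality with a loss of [2]^ th[: average]le_add_powR[and choose]tau [^ th] equal to
    the mean of [h], so that both terms are at most [tau]. *)
Lemma le_emean_powR f h S (th w : R) : measurable S -> measurable_fun setT f ->
  measurable_fun setT h -> (forall y, 0 <= f y) -> (forall y, 0 <= h y) -> 0 < w ->
  mu S = w%:E ->
  1 <= th -> (forall y, S y -> f y `^ th <= h y) ->
  ((w^-1%:E * \int[mu]_(y in S) (f y)%:E) `^ th <=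
    (2 `^ th)%:E * (w^-1%:E * \int[mu]_(y in S) (h y)%:E))%E.
Proof.
move=> mS mf mh f0 h0 w0 Sw th1 fh.
have If0 : (0 <= \int[mu]_(y in S) (f y)%:E)%E by apply: integral_ge0 => y _; rewrite lee_fin.
have Ih0 : (0 <= \int[mu]_(y in S) (h y)%:E)%E by apply: integral_ge0 => y _; rewrite lee_fin.
have th0 : 0 < th by lra.
have [hoo|hoo] := eqVneq (\int[mu]_(y in S) (h y)%:E)%E +oo%E.
  by rewrite hoo (gt0_muley (x := w^-1%:E)) ?lte_fin ?invr_gt0// gt0_muley ?leey// lte_fin powR_gt0.
have hfin : (\int[mu]_(y in S) (h y)%:E)%E \is a fin_num by rewrite ge0_fin_numE// ltey.
set A := w^-1 * fine (\int[mu]_(y in S) (h y)%:E).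
have EA : (w^-1%:E * \int[mu]_(y in S) (h y)%:E = A%:E)%E by rewrite EFinM fineK.
have A0 : 0 <= A by rewrite mulr_ge0 ?invr_ge0 ?(ltW w0)// fine_ge0.
have key tau : 0 < tau -> A <= tau `^ th ->
    (w^-1%:E * \int[mu]_(y in S) (f y)%:E <= (2 * tau)%:E)%E.
  move=> t0 At.
  have k0 : 0 <= tau `^ (1 - th) by exact: powR_ge0.
  have mhS : measurable_fun S (fun y => (h y)%:E).
    by apply/measurable_EFinP; exact: measurable_funTS.
  apply: (@le_trans _ _ (w^-1%:E * (\int[mu]_(y in S) (tau%:E + (tau `^ (1 - th))%:E * (h y)%:E)))%E).
    apply: lee_wpmul2l; first by rewrite lee_fin invr_ge0 ltW.
    apply: ge0_le_integral => //.
    - by move=> y _; rewrite lee_fin.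
    - by apply/measurable_EFinP; exact: measurable_funTS.
    - by apply: emeasurable_funD => //; exact: emeasurable_funM.
    - move=> y Sy; rewrite -EFinM -EFinD lee_fin.
      apply: (le_trans (le_add_powR (f0 y) t0 th1)); rewrite lerD2l.
      by apply: ler_wpM2l => //; exact: fh.
  rewrite ge0_integralD//; first last.
  - exact: emeasurable_funM.
  - by move=> y _; rewrite -EFinM lee_fin mulr_ge0.
  - by move=> y _; rewrite lee_fin ltW.
  rewrite integral_cst// Sw ge0_integralZl_EFin//; last by move=> y _; rewrite lee_fin.
  rewrite -(fineK hfin) -[leLHS]/((w^-1 * (tau * w + tau `^ (1 - th) *
    fine (\int[mu]_(y in S) (h y)%:E)))%:E) lee_fin mulrDr mulrCA mulVf ?gt_eqF// mulr1 mulrCA -/A.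
  have : tau `^ (1 - th) * A <= tau.
    apply: (@le_trans _ _ (tau `^ (1 - th) * tau `^ th)); first by apply: ler_wpM2l.
    have -> : tau `^ (1 - th) * tau `^ th = tau `^ 1.
      by rewrite -powRD ?subrK//; apply/implyP => _; rewrite gt_eqF.
    by rewrite powRr1// ltW.
  lra.
have I0 : (0 <= w^-1%:E * \int[mu]_(y in S) (f y)%:E)%E.
  by rewrite mule_ge0// lee_fin invr_ge0 ltW.
(* For [A = 0] the best [tau] would be 0, which is excluded; arbitrarily small values of [tau] are
   used instead. *)
rewrite EA; have [Az|An] := eqVneq A 0.
  rewrite Az mule0.
  suff -> : (w^-1%:E * \int[mu]_(y in S) (f y)%:E = 0)%E by rewrite poweR0r// gt_eqF.
  apply/eqP; rewrite eq_le I0 andbT; apply/lee_addgt0Pr => e e0; rewrite add0e.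
  have := key (e / 2); rewrite (_ : 2 * (e / 2) = e); last by field.
  apply; first by rewrite divr_gt0.
  by rewrite Az powR_ge0.
have Ap : 0 < A by rewrite lt_neqAle eq_sym An.
have := key (A `^ th^-1); rewrite powR_gt0// -powRrM mulVf ?gt_eqF// powRr1//.
move=> /(_ isT (lexx _)) /(le_poweR (ltW th0) I0) /le_trans; apply.
by rewrite poweR_EFin lee_fin powRM ?powR_ge0// -powRrM mulVf ?gt_eqF// powRr1.
Qed.

(** Cauchy-Schwarz through [h <= (2 * e)^-1 + e / 2 * h ^+ 2]; with [e = Num.sqrt w] both terms
    integrate to at most [e / 2]. *)
Lemma emean_sqr_le h S (w : R) : measurable S -> measurable_fun setT h ->
  (forall y, 0 <= h y) -> 0 < w -> mu S = w%:E ->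
  (\int[mu]_y (h y ^+ 2)%:E <= 1)%E ->
  exists A, [/\ (w^-1%:E * \int[mu]_(y in S) (h y)%:E = A%:E)%E, 0 <= A & A ^+ 2 <= w^-1].
Proof.
move=> mS mh h0 w0 Sw h2.
have Ih0 : (0 <= \int[mu]_(y in S) (h y)%:E)%E by apply: integral_ge0 => y _; rewrite lee_fin.
have fS : (mu S < +oo)%E by rewrite Sw ltry.
have fI : (\int[mu]_(y in S) (h y)%:E < +oo)%E.
  by apply: (integral_lty_sqr mS fS h0 mh); apply: le_lt_trans h2 _; exact: ltry.
have hfin : (\int[mu]_(y in S) (h y)%:E)%E \is a fin_num by rewrite ge0_fin_numE.
exists (w^-1 * fine (\int[mu]_(y in S) (h y)%:E)).
have I0 : 0 <= fine (\int[mu]_(y in S) (h y)%:E) by exact: fine_ge0.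
split; [by rewrite EFinM fineK|by rewrite mulr_ge0// invr_ge0 ltW|].
pose e := Num.sqrt w; have e0 : 0 < e by rewrite sqrtr_gt0.
have ew : e * e = w by rewrite -expr2 sqr_sqrtr// ltW.
have mh2 : measurable_fun setT (fun y => (h y ^+ 2)%:E).
  by apply/measurable_EFinP; exact: measurable_funX.
have Iw : fine (\int[mu]_(y in S) (h y)%:E) <= e.
  rewrite -lee_fin fineK//.
  apply: (@le_trans _ _ (\int[mu]_(y in S) ((2 * e)^-1%:E + (e / 2)%:E * (h y ^+ 2)%:E))%E).
    apply: ge0_le_integral => //.
    - by move=> y _; rewrite lee_fin.
    - by apply/measurable_EFinP; exact: measurable_funTS.
    - by apply: measurable_funTS; apply: emeasurable_funD => //; exact: emeasurable_funM.
    - move=> y _; rewrite -EFinM -EFinD lee_fin -(@ler_pM2l _ (2 * e)) ?mulr_gt0//.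
      rewrite mulrDr mulfV ?gt_eqF ?mulr_gt0//.
      have := sqr_ge0 (e * h y - 1); nra.
  rewrite ge0_integralD//; first last.
  - by apply: measurable_funTS; exact: emeasurable_funM.
  - by move=> y _; rewrite -EFinM lee_fin mulr_ge0 ?sqr_ge0// ltW// divr_gt0.
  - by move=> y _; rewrite lee_fin invr_ge0 mulr_ge0// ltW.
  rewrite integral_cst// Sw ge0_integralZl_EFin//; first last.
  - by rewrite ltW// divr_gt0.
  - exact: measurable_funTS.
  - by move=> y _; rewrite lee_fin sqr_ge0.
  have sub : (\int[mu]_(y in S) (h y ^+ 2)%:E <= 1%:E)%E.
    apply: le_trans h2; apply: ge0_subset_integral => //.
    by move=> y _; rewrite lee_fin sqr_ge0.
  apply: (@le_trans _ _ ((2 * e)^-1%:E * w%:E + (e / 2)%:E * 1%:E)%E).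
    by rewrite leeD2l//; apply: lee_wpmul2l => //; rewrite lee_fin ltW// divr_gt0.
  rewrite -!EFinM -EFinD lee_fin mulr1 -ew invfM mulrA divfK ?gt_eqF//; lra.
rewrite exprMn expr2 -mulrA ler_piMr ?invr_ge0 ?(ltW w0)//.
rewrite mulrC ler_pdivrMr// mul1r -ew expr2; exact: ler_pM.
Qed.

End integral_means.

(** * Pointwise consequences of the regularity of the exponent *)

Section exponent.
Context {R : realType}.
Implicit Types (p : plane R -> R) (x y : plane R).

Lemma ae_exists_in_square (Q : set (plane R)) x (e : R) : 0 < e ->
  (\forall y \ae (@leb2 R), Q y) ->
  exists y : plane R, [/\ Q y, `|y.1 - x.1| <= e & `|y.2 - x.2| <= e].
Proof.
move=> e0 [Z [mZ Z0 QZ]]; apply: contrapT => /forallNP h.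
pose P := Para x.1 x.2 0 e e.
have PZ : (pset P : set (plane R)) `<=` Z.
  move=> y [y1 y2]; apply: QZ => /= Qy; apply: (h y); split => //.
  by move: y2; rewrite /pline/= mul0r addr0.
have : (leb2 (pset P : set (plane R)) <= leb2 Z)%E.
  apply: le_measure; rewrite ?inE//.
  by apply: borel_plane; exact: measurable_pset.
rewrite [X in (_ <= X)%E]Z0 [X in (X <= _)%E]leb2_pset/=; [|exact: ltW|exact: ltW].
by rewrite lee_fin leNgt !mulr_gt0.
Qed.

Lemma edist_gt0 x y : x <> y -> 0 < Defs.edist x y.
Proof.
move=> xy; rewrite sqrtr_gt0 lt_neqAle addr_ge0 ?sqr_ge0// andbT eq_sym.
apply/eqP => /eqP; rewrite paddr_eq0 ?sqr_ge0// !sqrf_eq0 !subr_eq0.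
move=> /andP[/eqP h1 /eqP h2]; apply: xy.
by case: x y h1 h2 => [x1 x2] [y1 y2] /= -> ->.
Qed.

Lemma sqr_edist x y : Defs.edist x y ^+ 2 = (x.1 - y.1) ^+ 2 + (x.2 - y.2) ^+ 2.
Proof. by rewrite sqr_sqrtr// addr_ge0// sqr_ge0. Qed.

(** The form suited to a whole rectangle: a common bound [D] replaces the distance, and [x = y] is
    included. *)
Lemma modified_log_holder_le N c p x y (D : R) : 1 < N -> 0 < c ->
  modified_log_holder N c p -> 0 < D -> D ^+ 2 < N -> Defs.edist x y <= D ->
  `|(p x)^-1 - (p y)^-1| <= c * ln N / ln (N / D ^+ 2).
Proof.
move=> N1 c0 hp D0 DN xyD.
have D20 : 0 < D ^+ 2 by rewrite exprn_gt0.
have N0 : 0 <= N by lra.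
have lD : 0 < ln (N / D ^+ 2) by rewrite ln_gt0// ltr_pdivlMr// mul1r.
have [->|xy] := pselect (x = y).
  by rewrite subrr normr0 divr_ge0// ?(ltW lD)// mulr_ge0// ?(ltW c0)// ln_ge0// ltW.
rewrite ler_pdivlMr//; have e0 := edist_gt0 xy.
have eD : Defs.edist x y ^+ 2 <= D ^+ 2 by rewrite lerXn2r// ?nnegrE ?ltW.
have := hp x y xy; have -> : Defs.edist x y < Num.sqrt N.
  rewrite -(@ltr_pXn2r _ 2)// ?nnegrE ?sqrtr_ge0// ?(ltW e0)// [in ltRHS]sqr_sqrtr//.
  exact: le_lt_trans DN.
move=> /(_ isT); apply: le_trans; apply: ler_wpM2l => //.
rewrite ler_ln ?posrE ?divr_gt0 ?exprn_gt0//; try lra.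
by rewrite ler_pM2l; [rewrite lef_pV2// posrE exprn_gt0|lra].
Qed.

(** The reciprocal of [p] is continuous, so a point with [p x < P] would have a whole square of such
    points around it, and a square is not null. *)
Lemma ae_ge_everywhere N c p (P : R) : 1 < N -> 0 < c -> 0 < P ->
  modified_log_holder N c p -> (forall x, 0 < p x) ->
  (\forall x \ae (@leb2 R), P <= p x) -> forall x, P <= p x.
Proof.
move=> N1 c0 P0 hp p0 aeP x; rewrite leNgt; apply/negP => pP.
pose eta := (p x)^-1 - P^-1.
have eta0 : 0 < eta by rewrite subr_gt0 ltf_pV2 ?posrE.
have lN : 0 < ln N by rewrite ln_gt0.
(* Chosen so that [c * ln N / K] is below the gap [eta]; [D] is the distance at which the logarithm
   of [N / D ^+ 2] equals [K]. *)
pose K := c * ln N / eta + 1.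
have K0 : 0 < K by rewrite addr_gt0// divr_gt0// mulr_gt0.
pose D := Num.sqrt (N * expR (- K)).
have NK : 0 < N * expR (- K) by rewrite mulr_gt0 ?expR_gt0//; lra.
have D0 : 0 < D by rewrite sqrtr_gt0.
have D2 : D ^+ 2 = N * expR (- K) by rewrite sqr_sqrtr// ltW.
have DN : D ^+ 2 < N.
  by rewrite D2 -[ltRHS]mulr1 ltr_pM2l; [rewrite expR_lt1 oppr_lt0|lra].
have [y [Py y1 y2]] := ae_exists_in_square x (divr_gt0 D0 (ltr0n R 2)) aeP.
have : `|(p x)^-1 - (p y)^-1| <= c * ln N / ln (N / D ^+ 2).
  apply: (modified_log_holder_le N1 c0 hp D0 DN).
  rewrite -(@ler_pXn2r _ 2)// ?nnegrE ?sqrtr_ge0// ?(ltW D0)// sqr_edist.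
  have h (z : R) : `|z| <= D / 2 -> z ^+ 2 <= D ^+ 2 / 4.
    move=> hz; rewrite -(real_normK (num_real z)).
    by apply: (@le_trans _ _ ((D / 2) ^+ 2)); [rewrite lerXn2r// nnegrE; lra|lra].
  have := h (x.1 - y.1); rewrite distrC => /(_ y1).
  have := h (x.2 - y.2); rewrite distrC => /(_ y2).
  have := sqr_ge0 D; lra.
have -> : ln (N / D ^+ 2) = K.
  by rewrite D2 invfM mulrA mulfV ?gt_eqF//; [rewrite mul1r -expRN opprK expRK|lra].
have eK : c * ln N / K < eta.
  rewrite ltr_pdivrMr// /K mulrDr mulrCA mulfV ?gt_eqF//; lra.
have : (p y)^-1 <= P^-1 by rewrite lef_pV2 ?posrE.
have := ler_norm ((p x)^-1 - (p y)^-1); rewrite /eta in eK *; lra.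
Qed.

(** If [pinf] were smaller by [e], the condition would fail at [(t, 0)] with
    [ln t = |cinf| / e + 1], where its left-hand side is at least [|cinf| + e]. *)
Lemma log_holder_limit_ge p (P cinf pinf : R) :
  (forall x, P <= p x) ->
  (forall x, `|p x - pinf| * ln (expR 1 + enorm x) <= cinf) -> P <= pinf.
Proof.
move=> hP hp; rewrite leNgt; apply/negP => h.
pose e := P - pinf; have e0 : 0 < e by rewrite subr_gt0.
pose t := expR (`|cinf| / e + 1).
have t0 : 0 < t by exact: expR_gt0.
have := hp (t, 0); have -> : enorm ((t, 0) : plane R) = t.
  by rewrite /enorm/= expr0n addr0 sqrtr_sqr gtr0_norm.
have : ln t <= ln (expR 1 + t) by rewrite ler_ln ?posrE ?addr_gt0 ?expR_gt0// lerDr expR_ge0.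
rewrite {1}/t expRK => h1 h2.
have h3 : e <= `|p (t, 0) - pinf|.
  by apply: le_trans (ler_norm _); have := hP (t, 0); rewrite /e; lra.
have : e * (`|cinf| / e + 1) <= `|p (t, 0) - pinf| * ln (expR 1 + t).
  apply: ler_pM => //; first exact: ltW.
  by rewrite addr_ge0// divr_ge0// ltW.
rewrite mulrDr mulrCA mulfV ?gt_eqF//; have := ler_norm cinf; lra.
Qed.

(* The weight is the square of the maximal function of a square, which makes its integrability a case of the L^2 bound. *)
Lemma integrable_weight : exists W : plane R -> \bar R,
  [/\ measurable_fun setT W, forall x, (((expR 1 + enorm x) ^- 4)%:E <= W x)%E &
      (\int[leb2]_x W x < +oo)%E].
Proof.
pose B : set (R * R) := pset (Para 0 0 0 1 1).
have mB : measurable (B : set (plane R)) by apply: borel_plane; exact: measurable_pset.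
have lB : leb2 (B : set (plane R)) = 4%:E.
  by rewrite leb2_pset//= ?mul1r ?mulr1.
pose f : plane R -> R := \1_(B : set (plane R)).
have mf : measurable_fun setT f by exact: measurable_indic.
pose N : R := expR 1; have [_ /ltW N1 N0 _] := expR1_le_facts (lexx N).
have [C C0 hC] := @kakeya_L2 R.
(* [B] has area 4 and lies with [x] in a rectangle of area at most [16 * (N * D * D)]; this factor
   turns the square of the resulting average into [D ^- 4]. *)
pose k := (4 * N) ^+ 2; have k0 : 0 < k by rewrite exprn_gt0// mulr_gt0.
exists (fun x => k%:E * kakeya N f x `^ 2)%E; split.
- apply: emeasurable_funM; first exact: measurable_cst.
  exact: measurable_poweR_comp (measurable_kakeya N1 mf).
- move=> x; pose D := expR 1 + enorm x.
  have D1 : 1 <= D by rewrite /D -/N; have : 0 <= enorm x by [exact: sqrtr_ge0]; lra.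
  have D0 : 0 < D by lra.
  have u1 : ((1, 0) : R * R).1 ^+ 2 + ((1, 0) : R * R).2 ^+ 2 = 1.
    by rewrite /= expr1n expr0n addr0.
  pose S := rectangle ((0, 0) : R * R) (1, 0) (N * D) D.
  have RS : rectangles N S by exists (0, 0), (1, 0), D.
  have DN : D <= N * D by rewrite ler_peMl// ltW.
  have le_enorm (a b : R) : `|a| <= Num.sqrt (a ^+ 2 + b ^+ 2).
    by rewrite -sqrtr_sqr ler_sqrt ?lerDl ?sqr_ge0// addr_ge0 ?sqr_ge0.
  have Sx : S x.
    have h1 : `|x.1| <= D.
      by apply: (le_trans (le_enorm _ x.2)); rewrite lerDr expR_ge0.
    have h2 : `|x.2| <= D.
      by apply: (le_trans (le_enorm _ x.1)); rewrite addrC lerDr expR_ge0.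
    by split; rewrite /= !subr0 !mulr1 mulr0 ?addr0 ?subr0//; lra.
  have BS : (B : set (plane R)) `<=` S.
    move=> y [/=]; rewrite /pline/= mul0r addr0 !subr0 => y1 y2.
    by split; rewrite /= !subr0 !mulr1 mulr0 ?addr0 ?subr0//; lra.
  have mS := rectangles_measurable RS.
  have /andP[b1 b2] := leb2_rectangle_bounds ((0, 0) : R * R) u1 D0 DN.
  have /andP[S0 Soo] := rectangles_fin N1 RS.
  have fS0 : 0 < fine (leb2 S) by rewrite fine_gt0// S0.
  have fS : fine (leb2 S) <= 16 * (N * D * D).
    by rewrite -lee_fin fineK// ge0_fin_numE.
  have avg : ((4 / (16 * (N * D * D)))%:E <= average f S)%E.
    rewrite (averageE f N1 RS) (eq_integral (fun y => (\1_(B : set (plane R)) y)%:E)); last first.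
      by move=> y _; rewrite /= ger0_norm.
    rewrite integral_indic// setIidl// [X in (_ * X)%E]lB -EFinM lee_fin mulrC.
    by apply: ler_wpM2r => //; rewrite lef_pV2 ?posrE// !mulr_gt0.
  have a0 : 0 <= 4 / (16 * (N * D * D)).
    by rewrite divr_ge0// !mulr_ge0// ltW.
  have a0' : (0 <= (4 / (16 * (N * D * D)))%:E)%E by rewrite lee_fin.
  have two0 : 0 <= 2 :> R by [].
  have := le_poweR two0 a0' (le_trans avg (average_le_kakeya f RS Sx)).
  rewrite poweR_EFin powR_mulrn// => h.
  apply: (@le_trans _ _ (k%:E * ((4 / (16 * (N * D * D))) ^+ 2)%:E)%E); last first.
    by apply: lee_wpmul2l => //; rewrite lee_fin ltW.
  rewrite -EFinM lee_fin /k -exprMn -/D.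
  rewrite (_ : 4 * N * (4 / (16 * (N * D * D))) = (D ^+ 2)^-1); last first.
    by field; rewrite !gt_eqF.
  by rewrite exprVn -exprM.
- have fin : (\int[leb2]_x (`|f x|%R ^+ 2)%:E < +oo)%E.
    rewrite (eq_integral (fun y => (\1_(B : set (plane R)) y)%:E)); last first.
      move=> y _; rewrite /= ger0_norm// /f indicE.
      by case: (_ \in _); rewrite ?expr1n ?expr0n.
    by rewrite integral_indic// setIT [X in (X < _)%E]lB ltry.
  have mK := measurable_poweR_comp 2 (measurable_kakeya N1 mf).
  have K0 x : [set: plane R] x -> (0 <= kakeya N f x `^ 2)%E.
    by move=> _; exact: poweR_ge0.
  rewrite (ge0_integralZl_EFin _ measurableT K0 mK (ltW k0)).
  have := hC N f (lexx _) mf; set I := (\int[leb2]_x (_ `^ _))%E => h.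
  have I0 : (0 <= I)%E by apply: integral_ge0 => x _; exact: poweR_ge0.
  have II : (I < +oo)%E.
    apply: (le_lt_trans h); apply: lte_mul_pinfty => //.
    by rewrite lee_fin mulr_ge0 ?sqr_ge0// ltW.
  by apply: lte_mul_pinfty => //; rewrite lee_fin ltW.
Qed.

End exponent.

(** * Values at least 1: nearly constant exponent on a rectangle *)

Section local_part.
Context {R : realType}.
Implicit Types (p f h : plane R -> R) (x y : plane R).

Lemma rectangle_edist_le c u (N s : R) x y : 1 <= N -> 0 < s ->
  u.1 ^+ 2 + u.2 ^+ 2 = 1 ->
  rectangle c u (N * s) s x -> rectangle c u (N * s) s y ->
  Defs.edist x y <= 4 * (N * s).
Proof.
move=> N1 s0 u1 [x1 x2] [y1 y2].
have sN : s <= N * s by rewrite ler_peMl// ltW.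
rewrite -(@ler_pXn2r _ 2)// ?nnegrE ?sqrtr_ge0//; last lra.
rewrite sqr_edist.
pose al := (x.1 - y.1) * u.1 + (x.2 - y.2) * u.2.
pose be := (x.2 - y.2) * u.1 - (x.1 - y.1) * u.2.
have -> : (x.1 - y.1) ^+ 2 + (x.2 - y.2) ^+ 2 = al ^+ 2 + be ^+ 2.
  rewrite -[LHS]mulr1 -u1 /al /be; ring.
have ha : `|al| <= 2 * (N * s).
  rewrite /al [X in `|X|](_ : _ = ((x.1 - c.1) * u.1 + (x.2 - c.2) * u.2) -
    ((y.1 - c.1) * u.1 + (y.2 - c.2) * u.2)); last by ring.
  by apply: (le_trans (ler_normB _ _)); lra.
have hb : `|be| <= 2 * (N * s).
  rewrite /be [X in `|X|](_ : _ = ((x.2 - c.2) * u.1 - (x.1 - c.1) * u.2) -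
    ((y.2 - c.2) * u.1 - (y.1 - c.1) * u.2)); last by ring.
  by apply: (le_trans (ler_normB _ _)); lra.
have sq (z : R) : `|z| <= 2 * (N * s) -> z ^+ 2 <= (2 * (N * s)) ^+ 2.
  move=> hz; rewrite -(real_normK (num_real z)).
  by rewrite lerXn2r// nnegrE//; lra.
have := sq _ ha; have := sq _ hb; have := sqr_ge0 (N * s).
set t := N * s => t0 h1 h2; lra.
Qed.

(* [iota] is the reciprocal of an exponent that is at most [p] on the whole rectangle. *)
Lemma local_exponent (N c : R) p (S : set (plane R)) x : 1 < N -> 0 < c ->
  modified_log_holder N c p -> (forall y, 2 <= p y) -> rectangles N S -> S x ->
  exists iota : R, [/\ (p x)^-1 <= iota, iota <= 2^-1,
    forall y, S y -> (p y)^-1 <= iota &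
    ((fine (leb2 S))^-1) `^ (iota - (p x)^-1) <= 6 * N `^ c].
Proof.
move=> N1 c0 hp p2 RS Sx; have [cc [u [s [u1 s0 SE]]]] := RS.
have N0 : 0 < N by lra.
have N1' : 1 <= N by lra.
have p0 y : 0 < p y by exact: lt_le_trans (ltr0n _ 2) (p2 y).
have ip y : (p y)^-1 <= 2^-1 by rewrite lef_pV2 ?posrE.
have /andP[S0 Soo] := rectangles_fin N1' RS.
set w := fine (leb2 S).
have w0 : 0 < w by rewrite fine_gt0// S0.
have sN : s <= N * s by rewrite ler_peMl// ltW.
have wlow : N * s * s / 2 <= w.
  have /andP[h1 _] := leb2_rectangle_bounds cc u1 s0 sN.
  by rewrite -lee_fin fineK ?ge0_fin_numE// SE.
pose D := 4 * (N * s); have D0 : 0 < D by rewrite !mulr_gt0.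
have D20 : 0 < D ^+ 2 by rewrite exprn_gt0.
(* From [w >= N * s ^+ 2 / 2] and [D = 4 * (N * s)]. The power of 32 that arises is at most 36 to
   the 1 / 2, which is the 6 of the statement. *)
have wD : w^-1 <= 32 * (N / D ^+ 2).
  rewrite mulrA ler_pdivlMr// mulrC ler_pdivrMr//.
  have : N * (N * s * s / 2) <= N * w by rewrite ler_pM2l.
  rewrite /D; lra.
have Nc1 : 1 <= N `^ c by rewrite -(powRr0 N) ler_powR// ltW.
have c6 (k : R) : 0 <= k -> k <= 2^-1 -> (32 : R) `^ k <= 6.
  move=> k0 k2; apply: (@le_trans _ _ ((36 : R) `^ 2^-1)).
    apply: (@le_trans _ _ ((32 : R) `^ 2^-1)); first by rewrite ler_powR//; lra.
    by apply: ge0_ler_powR; rewrite ?nnegrE//; lra.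
  rewrite powR12_sqrt; last lra.
  by rewrite (_ : 36 = 6 ^+ 2); [rewrite sqrtr_sqr ger0_norm; lra|lra].
(* On large rectangles the modified condition gives nothing, but then [w^-1 <= 32] and the exponent
   2 can be used. *)
have [DN|ND] := ltP (D ^+ 2) N; last first.
  exists 2^-1; split => //.
  set k := 2^-1 - _; have k0 : 0 <= k by rewrite subr_ge0.
  have k2 : k <= 2^-1 by rewrite gerBl invr_ge0 ltW.
  apply: (@le_trans _ _ ((32 : R) `^ k)).
    apply: ge0_ler_powR; rewrite ?nnegrE ?invr_ge0 ?(ltW w0)//.
    apply: (le_trans wD); rewrite ler_piMr// ler_pdivrMr// mul1r//.
  by apply: (le_trans (c6 _ k0 k2)); rewrite ler_peMr.
have lD : 0 < ln (N / D ^+ 2) by rewrite ln_gt0// ltr_pdivlMr// mul1r.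
pose dl := c * ln N / ln (N / D ^+ 2).
have dl0 : 0 <= dl by rewrite divr_ge0 ?(ltW lD)// mulr_ge0 ?(ltW c0)// ln_ge0.
exists (Num.min 2^-1 ((p x)^-1 + dl)); split.
- by rewrite le_min ip lerDl.
- by rewrite ge_min lexx.
- move=> y Sy; rewrite le_min ip/=.
  have xyD : Defs.edist x y <= D.
    by move: Sx Sy; rewrite SE; exact: rectangle_edist_le.
  have := modified_log_holder_le N1 c0 hp D0 DN xyD; rewrite -/dl distrC.
  by have := ler_norm ((p y)^-1 - (p x)^-1); lra.
set k := _ - _.
have k0 : 0 <= k by rewrite subr_ge0 le_min ip lerDl.
have k2 : k <= 2^-1.
  rewrite lerBlDr (@le_trans _ _ 2^-1)// ?ge_min ?lexx// lerDl invr_ge0 ltW//.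
have kd : k <= dl by rewrite lerBlDl ge_min lexx orbT.
apply: (@le_trans _ _ ((32 * (N / D ^+ 2)) `^ k)).
  apply: ge0_ler_powR; rewrite ?nnegrE ?invr_ge0 ?(ltW w0)//.
  by rewrite mulr_ge0// divr_ge0// ltW.
rewrite powRM//; last by rewrite divr_ge0// ltW.
apply: ler_pM; rewrite ?powR_ge0//; first exact: c6.
rewrite /powR !gt_eqF// ?divr_gt0// ler_expR.
apply: (@le_trans _ _ (dl * ln (N / D ^+ 2))); first by rewrite ler_pM2r.
by rewrite /dl divfK// gt_eqF.
Qed.

Lemma average_local_le (N c : R) p f (S : set (plane R)) x : 1 < N -> 0 < c ->
  modified_log_holder N c p -> (forall y, 2 <= p y) -> measurable_fun setT p ->
  measurable_fun setT f -> (forall y, 0 <= f y) ->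
  (forall y, f y != 0 -> 1 <= f y) ->
  (\int[leb2]_y (f y `^ p y)%:E <= 1)%E -> rectangles N S -> S x ->
  (average f S `^ p x <= ((12 * N `^ c) `^ p x)%:E *
     average (fun y => (f y `^ (p y / 2))%R) S `^ 2)%E.
Proof.
move=> N1 c0 hp p2 mp mf f0 f1 fp RS Sx.
have N1' : 1 <= N by lra.
have [io [io1 io2 io3 io4]] := local_exponent N1 c0 hp p2 RS Sx.
have p0 y : 0 < p y by exact: lt_le_trans (ltr0n _ 2) (p2 y).
set w := fine (leb2 S) in io4.
have /andP[S0 Soo] := rectangles_fin N1' RS.
have w0 : 0 < w by rewrite fine_gt0// S0.
have Sw : leb2 S = w%:E by rewrite fineK// ge0_fin_numE.
have mS := rectangles_measurable RS.
pose h y := f y `^ (p y / 2).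
have h0 y : 0 <= h y by exact: powR_ge0.
have mh : measurable_fun setT h.
  apply: measurable_powR_fun mf _; apply: measurable_funM mp _.
  exact: measurable_cst.
have h2E y : h y ^+ 2 = f y `^ p y.
  by rewrite -powR_mulrn// -powRrM divfK.
have h2 : (\int[leb2]_y (h y ^+ 2)%:E <= 1)%E.
  by under eq_integral do rewrite h2E.
have [A [EA A0 A2]] := emean_sqr_le mS mh h0 w0 Sw h2.
have av (g : plane R -> R) : (forall y, 0 <= g y) ->
    average g S = (w^-1%:E * \int[leb2]_(y in S) (g y)%:E)%E.
  move=> g0; rewrite (averageE g N1' RS) -/w; congr (_ * _)%E.
  by apply: eq_integral => y _; rewrite gee0_abs// lee_fin.
rewrite -/(h) (av h h0) EA (av f f0).
have io0 : 0 < io by apply: lt_le_trans io1; rewrite invr_gt0.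
pose th := (2 * io)^-1.
have th1 : 1 <= th by rewrite /th invf_ge1//; [lra|rewrite mulr_gt0].
have th0 : 0 < th by lra.
(* Each value of [f] is 0 or at least 1, so lowering the exponent from [p y / 2] to [th] does not
   increase the power. *)
have fh y : S y -> f y `^ th <= h y.
  move=> Sy; have [->|fn] := eqVneq (f y) 0.
    by rewrite powR0 ?gt_eqF.
  rewrite /h ler_powR ?f1// /th invfM [leRHS]mulrC ler_pM2l ?invr_gt0//.
  by rewrite -[leRHS]invrK lef_pV2 ?posrE ?invr_gt0//; exact: io3.
have := le_emean_powR mS mf mh f0 h0 w0 Sw th1 fh.
rewrite EA; set F := (_ * _)%E => Fth.
have F0 : (0 <= F)%E.
  by rewrite mule_ge0 ?lee_fin ?invr_ge0 ?(ltW w0)// integral_ge0// => y _; rewrite lee_fin.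
have FA : (F <= (2 * A `^ th^-1)%:E)%E.
  rewrite -(@poweRVK _ F th) ?gt_eqF//.
  have ti0 : 0 <= th^-1 by rewrite invr_ge0 ltW.
  apply: (le_trans (le_poweR ti0 (poweR_ge0 _ _) Fth)).
  by rewrite -EFinM poweR_EFin lee_fin powRM ?powR_ge0// -powRrM mulfV ?gt_eqF// powRr1.
apply: (le_trans (le_poweR (ltW (p0 x)) F0 FA)).
rewrite !poweR_EFin -EFinM lee_fin powRM ?powR_ge0//.
have -> : (12 * N `^ c) `^ p x = 2 `^ p x * (6 * N `^ c) `^ p x.
  by rewrite -powRM ?mulr_ge0 ?powR_ge0// mulrA -natrM.
rewrite -mulrA; apply: ler_wpM2l; first exact: powR_ge0.
have [->|An] := eqVneq A 0.
  have thn : th^-1 != 0 by rewrite gt_eqF// invr_gt0.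
  have pn : p x != 0 by rewrite gt_eqF.
  by rewrite (powR0 thn) (powR0 pn) mulr_ge0 ?powR_ge0.
have Ap : 0 < A by rewrite lt_neqAle eq_sym An.
pose k := io - (p x)^-1; have k0 : 0 <= k by rewrite subr_ge0.
(* Splits off the square kept for the L^2 bound. The surplus is controlled by [A ^+ 2 <= w^-1] and
   the choice of [io], giving 6; with the 2 of [le_emean_powR] this makes 12. *)
have -> : (A `^ th^-1) `^ p x = ((A ^+ 2) `^ k) `^ p x * A `^ 2.
  rewrite -!powRrM -powR_mulrn// -powRrM -powRD; last first.
    by apply/implyP => _; rewrite gt_eqF.
  congr (_ `^ _); rewrite /th invrK /k; by field; rewrite gt_eqF// p0.
apply: ler_wpM2r; first exact: powR_ge0.
apply: ge0_ler_powR; rewrite ?nnegrE ?powR_ge0 ?(ltW (p0 x))//.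
  by rewrite mulr_ge0// powR_ge0.
apply: le_trans io4; apply: ge0_ler_powR => //; rewrite nnegrE ?sqr_ge0//.
by rewrite invr_ge0 ltW.
Qed.

End local_part.

Section integral_comparison.
Context d (T : measurableType d) (R : realType) (mu : {measure set T -> \bar R}).
Implicit Types F G W : T -> \bar R.

Lemma integral_affine_le F G W (k : R) : 0 <= k ->
  (forall x, 0 <= F x)%E -> (forall x, 0 <= G x)%E -> (forall x, 0 <= W x)%E ->
  measurable_fun setT F -> measurable_fun setT G -> measurable_fun setT W ->
  (forall x, F x <= k%:E * G x + W x)%E ->
  (\int[mu]_x F x <= k%:E * \int[mu]_x G x + \int[mu]_x W x)%E.
Proof.
move=> k0 F0 G0 W0 mF mG mW FGW.
have mkG : measurable_fun setT (fun x => k%:E * G x)%E by exact: emeasurable_funM.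
have kG0 x : (0 <= k%:E * G x)%E by rewrite mule_ge0.
rewrite -ge0_integralZl_EFin// -ge0_integralD//.
by apply: ge0_le_integral => //; exact: emeasurable_funD.
Qed.

Lemma le_integralT F G : (forall x, 0 <= F x)%E ->
  measurable_fun setT F -> measurable_fun setT G -> (forall x, F x <= G x)%E ->
  (\int[mu]_x F x <= \int[mu]_x G x)%E.
Proof. by move=> F0 mF mG FG; exact: ge0_le_integral. Qed.

Lemma integral_le_measure (S : set T) (f : T -> R) : measurable S ->
  measurable_fun setT f -> (forall x, 0 <= f x <= 1) ->
  (\int[mu]_(x in S) `|(f x)%:E| <= mu S)%E.
Proof.
move=> mS mf f01; rewrite -[leRHS]mul1e -integral_cst//.
apply: ge0_le_integral => //; first exact: measurable_abse_EFin.
by move=> x _; have /andP[h1 h2] := f01 x; rewrite gee0_abs lee_fin.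
Qed.

Lemma integral_normD (S : set T) (f g h : T -> R) : measurable S ->
  measurable_fun setT f -> measurable_fun setT g ->
  (forall x, `|h x| = f x + g x) -> (forall x, 0 <= f x) -> (forall x, 0 <= g x) ->
  (\int[mu]_(x in S) `|(h x)%:E| =
   \int[mu]_(x in S) `|(f x)%:E| + \int[mu]_(x in S) `|(g x)%:E|)%E.
Proof.
move=> mS mf mg hfg f0 g0.
rewrite -ge0_integralD//; try exact: measurable_abse_EFin.
apply: eq_integral => x _; rewrite !abse_EFin hfg !ger0_norm//.
Qed.

End integral_comparison.

Section ereal_convexity.
Context {R : realType}.

(** The half sum is at most the larger term. Thus no factor depending on [r] appears, which matters
    because [r] will be the variable [p x]. *)
Lemma half_add_poweR_le (a b : \bar R) (r : R) : 0 <= r -> (0 <= a)%E -> (0 <= b)%E ->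
  ((2^-1%:E * (a + b)) `^ r <= a `^ r + b `^ r)%E.
Proof.
move=> r0; wlog ab : a b / (a <= b)%E.
  move=> H a0 b0; have [|/ltW] := leP a b; first by move=> h; exact: H.
  by move=> h; rewrite addeC [leRHS]addeC; exact: H.
move=> a0 b0; apply: (@le_trans _ _ (b `^ r)%E); last by rewrite leeDr// poweR_ge0.
apply: le_poweR => //; first by rewrite mule_ge0 ?adde_ge0// lee_fin invr_ge0.
apply: (@le_trans _ _ (2^-1%:E * (b + b))%E).
  by apply: lee_wpmul2l; rewrite ?lee_fin ?invr_ge0// leeD2r.
case: b b0 {ab} => [b| |]// b0; last by rewrite leey.
by rewrite -EFinD -EFinM lee_fin; lra.
Qed.

Lemma scale_poweR_le (a B : \bar R) (k r : R) : 0 < k -> (0 <= a)%E -> (0 <= B)%E ->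
  (a `^ r <= (k `^ r)%:E * B)%E -> ((k^-1%:E * a) `^ r <= B)%E.
Proof.
move=> k0 a0 B0 h; rewrite poweRM// ?lee_fin ?invr_ge0 ?(ltW k0)// poweR_EFin.
apply: (@le_trans _ _ ((k^-1 `^ r)%:E * ((k `^ r)%:E * B))%E).
  by apply: lee_wpmul2l => //; rewrite lee_fin powR_ge0.
rewrite muleA -EFinM -powRM ?invr_ge0 ?(ltW k0)// mulVf ?gt_eqF// powR1 mul1e//.
Qed.

End ereal_convexity.

(** * Modular estimates for the two parts of a function *)

Section modular_estimates.
Context {R : realType}.
Implicit Types (p f h : plane R -> R) (x y : plane R).

Lemma kakeya_le1 (N : R) f x : 1 <= N -> measurable_fun setT f ->
  (forall y, 0 <= f y <= 1) -> (kakeya N f x <= 1)%E.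
Proof.
move=> N1 mf f01; apply: ge_ereal_sup => _ [S [RS Sx] <-].
have /andP[S0 Soo] := rectangles_fin N1 RS.
have mS := rectangles_measurable RS.
have w0 : 0 < fine (leb2 S) by rewrite fine_gt0// S0.
rewrite (averageE f N1 RS).
apply: (@le_trans _ _ ((fine (leb2 S))^-1%:E * leb2 S)%E).
  apply: lee_wpmul2l; first by rewrite lee_fin invr_ge0 ltW.
  exact: (integral_le_measure _ mS mf f01).
rewrite -[X in (_ * X)%E](@fineK _ (leb2 S)) ?ge0_fin_numE//.
by rewrite -EFinM lee_fin mulVf ?gt_eqF.
Qed.

Lemma kakeya_leD (N : R) f g h x : 1 <= N -> measurable_fun setT f ->
  measurable_fun setT g -> (forall y, `|h y| = f y + g y) ->
  (forall y, 0 <= f y) -> (forall y, 0 <= g y) ->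
  (kakeya N h x <= kakeya N f x + kakeya N g x)%E.
Proof.
move=> N1 mf mg hfg f0 g0; apply: ge_ereal_sup => _ [S [RS Sx] <-].
have mS := rectangles_measurable RS.
apply: (@le_trans _ _ (average f S + average g S)%E).
  rewrite !(averageE _ N1 RS) (integral_normD _ mS mf mg hfg f0 g0).
  rewrite ge0_muleDr//; exact: integral_ge0.
by apply: leeD; exact: average_le_kakeya.
Qed.

Lemma sqr_average_le_kakeya (N : R) f (S : set (plane R)) x : rectangles N S -> S x ->
  (average f S `^ 2 <= kakeya N f x `^ 2)%E.
Proof.
move=> RS Sx; have two0 : 0 <= 2 :> R by [].
exact: (le_poweR two0 (average_ge0 f S) (average_le_kakeya f RS Sx)).
Qed.

Lemma kakeya_power_le (N th : R) f x : 1 <= N -> 1 <= th -> measurable_fun setT f ->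
  (forall y, 0 <= f y) ->
  (kakeya N f x `^ (2 * th) <=
   (2 `^ (2 * th))%:E * kakeya N (fun y => (f y `^ th)%R) x `^ 2)%E.
Proof.
move=> N1 th1 mf f0; have th0 : 0 < th by lra.
pose h y := f y `^ th.
have h0 y : 0 <= h y by exact: powR_ge0.
have mh : measurable_fun setT h.
  by apply: measurable_powR_fun mf _; exact: measurable_cst.
have K0 := kakeya_ge0 f x N1.
have B0 : (0 <= (2 `^ (2 * th))%:E * kakeya N h x `^ 2)%E.
  by rewrite mule_ge0 ?poweR_ge0// lee_fin powR_ge0.
apply: ereal_sup_poweR_le => //; first by rewrite mulr_gt0.
move=> _ [S [RS Sx] <-]; split; first exact: average_ge0.
have /andP[S0 Soo] := rectangles_fin N1 RS.
have mS := rectangles_measurable RS.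
have w0 : 0 < fine (leb2 S) by rewrite fine_gt0// S0.
have Sw : leb2 S = (fine (leb2 S))%:E by rewrite fineK// ge0_fin_numE.
have av (g : plane R -> R) : (forall y, 0 <= g y) ->
    average g S = ((fine (leb2 S))^-1%:E * \int[leb2]_(y in S) (g y)%:E)%E.
  move=> g0; rewrite (averageE g N1 RS); congr (_ * _)%E.
  by apply: eq_integral => y _; rewrite gee0_abs// lee_fin.
have := le_emean_powR mS mf mh f0 h0 w0 Sw th1 (fun y _ => lexx _).
rewrite -(av _ f0) -(av _ h0) => hh.
have two0 : 0 <= 2 :> R by [].
rewrite mulrC poweRrM; apply: (le_trans (le_poweR two0 (poweR_ge0 _ _) hh)).
rewrite poweRM ?lee_fin ?powR_ge0 ?average_ge0// poweR_EFin -powRrM.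
apply: lee_wpmul2l; first by rewrite lee_fin powR_ge0.
exact: sqr_average_le_kakeya.
Qed.

Lemma integral_local_le : exists2 C : R, 0 < C & forall (N c : R) p f,
  expR 1 <= N -> 0 < c -> modified_log_holder N c p -> (forall y, 2 <= p y) ->
  measurable_fun setT p -> measurable_fun setT f -> (forall y, 0 <= f y) ->
  (forall y, f y != 0 -> 1 <= f y) ->
  (\int[leb2]_y (f y `^ p y)%:E <= 1)%E ->
  (\int[leb2]_x (((12 * N `^ c)^-1%:E * kakeya N f x) `^ p x) <= (C * (ln N) ^+ 2)%:E)%E.
Proof.
have [C C0 hC] := @kakeya_L2 R; exists C => //.
move=> N c p f eN c0 hp p2 mp mf f0 f1 fp.
have [_ N1 N0 _] := expR1_le_facts eN; have N1' := ltW N1.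
have p0 y : 0 < p y by exact: lt_le_trans (ltr0n _ 2) (p2 y).
pose h y := f y `^ (p y / 2).
have mh : measurable_fun setT h.
  apply: measurable_powR_fun mf _; apply: measurable_funM mp _.
  exact: measurable_cst.
have k0 : 0 < 12 * N `^ c by rewrite mulr_gt0// powR_gt0.
have K0 x := kakeya_ge0 f x N1'.
have mK := measurable_kakeya N1' mf.
have mkK : measurable_fun setT (fun x => (12 * N `^ c)^-1%:E * kakeya N f x)%E.
  by apply: emeasurable_funM mK; exact: measurable_cst.
have kK0 x : (0 <= (12 * N `^ c)^-1%:E * kakeya N f x)%E.
  by rewrite mule_ge0// lee_fin invr_ge0 ltW.
apply: (@le_trans _ _ (\int[leb2]_x (kakeya N h x `^ 2))%E).
  apply: le_integralT.
  - by move=> x; exact: poweR_ge0.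
  - exact: measurable_poweR_fun.
  - exact: measurable_poweR_comp (measurable_kakeya N1' mh).
  move=> x; apply: scale_poweR_le => //; first exact: poweR_ge0.
  apply: (ereal_sup_poweR_le (p0 x) _ (K0 x)).
    by rewrite mule_ge0 ?poweR_ge0// lee_fin powR_ge0.
  move=> _ [S [RS Sx] <-]; split; first exact: average_ge0.
  apply: (le_trans (average_local_le N1 c0 hp p2 mp mf f0 f1 fp RS Sx)).
  apply: lee_wpmul2l; first by rewrite lee_fin powR_ge0.
  exact: sqr_average_le_kakeya.
apply: (le_trans (hC N h eN mh)); rewrite -[leRHS]mule1.
apply: lee_wpmul2l; first by rewrite lee_fin mulr_ge0 ?sqr_ge0// ltW.
apply: le_trans fp; rewrite le_eqVlt; apply/orP; left; apply/eqP.
apply: eq_integral => y _; congr EFin.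
by rewrite ger0_norm ?powR_ge0// -powR_mulrn ?powR_ge0// -powRrM divfK.
Qed.

(** [powR_exponent_change] is used twice: from [q] to [p] on [f], and from [p] to [q] on
    [kakeya N f], which is at most 1 as well. In between, at the constant exponent [q],
    [kakeya_power_le] reduces to the L^2 bound for the power [q / 2] of [f]. *)
Lemma integral_global_le p (cinf q : R) : (forall y, 2 <= p y) -> 2 <= q ->
  measurable_fun setT p ->
  (forall x, `|p x - q| * ln (expR 1 + enorm x) <= cinf) ->
  exists2 C : R, 0 < C & forall (N : R) f, expR 1 <= N ->
  measurable_fun setT f -> (forall y, 0 <= f y <= 1) ->
  (\int[leb2]_y (f y `^ p y)%:E <= 1)%E ->
  (\int[leb2]_x (kakeya N f x `^ p x) <= (C * (ln N) ^+ 2)%:E)%E.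
Proof.
move=> p2 q2 mp hp; have [C C0 hC] := @kakeya_L2 R.
have [W [mW WD Wfin]] := @integrable_weight R.
have p0 y : 0 < p y by exact: lt_le_trans (ltr0n _ 2) (p2 y).
have q0 : 0 < q by lra.
have D1 x : 1 < expR 1 + enorm x :> R.
  have : 0 <= enorm x by exact: sqrtr_ge0.
  by have := expR_ge1Dx (1 : R); lra.
have W0 x : (0 <= W x)%E.
  apply: le_trans (WD x); rewrite lee_fin invr_ge0 exprn_ge0//.
  by have := D1 x; lra.
have IW0 : (0 <= \int[leb2]_x W x)%E by exact: integral_ge0.
have Wfn : (\int[leb2]_x W x)%E \is a fin_num by rewrite ge0_fin_numE.
set w := fine (\int[leb2]_x W x)%E.
have w0 : 0 <= w by exact: fine_ge0.
have IW : (\int[leb2]_x W x = w%:E)%E by rewrite fineK.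
pose E := expR (2 * cinf); have E0 : 0 < E by exact: expR_gt0.
exists (E * 2 `^ q * C * (E + w) + w + 1).
  by rewrite ltr_wpDl// addr_ge0// !mulr_ge0 ?powR_ge0 ?(ltW E0) ?(ltW C0)// addr_ge0// ltW.
move=> N f eN mf f01 fp.
have [_ /ltW N1 N0 l1] := expR1_le_facts eN.
have f0 y : 0 <= f y by have /andP[] := f01 y.
have f1 y : f y <= 1 by have /andP[] := f01 y.
pose h y := f y `^ (q / 2).
have h0 y : 0 <= h y by exact: powR_ge0.
have mh : measurable_fun setT h.
  by apply: measurable_powR_fun mf _; exact: measurable_cst.
have h2E y : h y ^+ 2 = f y `^ q by rewrite -powR_mulrn// -powRrM divfK.
have mfr (r : plane R -> R) : measurable_fun setT r -> measurable_fun setT (fun y => (f y `^ r y)%:E).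
  by move=> mr; apply/measurable_EFinP; exact: measurable_powR_fun.
have fr0 (r : plane R -> R) y : (0 <= (f y `^ r y)%:E)%E by rewrite lee_fin powR_ge0.
have hq : (\int[leb2]_y (f y `^ q)%:E <= (E + w)%:E)%E.
  have qmeas := measurable_cst q.
  have := @integral_affine_le _ _ _ (@leb2 R) (fun y => (f y `^ q)%:E)
    (fun y => (f y `^ p y)%:E) W E (ltW E0) (fr0 (fun=> q)) (fr0 p) W0
    (mfr (fun=> q) (measurable_cst q)) (mfr p mp) mW.
  rewrite IW => hI; apply: (le_trans (hI _)) => [x|].
    apply: (@le_trans _ _ ((E * f x `^ p x + (expR 1 + enorm x) ^- 4)%:E)); last first.
      by rewrite EFinD EFinM leeD2l.
    rewrite lee_fin; apply: powR_exponent_change => //.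
    by rewrite distrC.
  rewrite EFinD leeD2r// -[leRHS]mule1; apply: lee_wpmul2l => //.
  by rewrite lee_fin ltW.
have K0 x := kakeya_ge0 f x N1.
have mK := measurable_kakeya N1 mf.
have Kh0 x : (0 <= kakeya N h x `^ 2)%E by exact: poweR_ge0.
have mKh := measurable_poweR_comp 2 (measurable_kakeya N1 mh).
have Kp0 x : (0 <= kakeya N f x `^ p x)%E by exact: poweR_ge0.
have mKp := measurable_poweR_fun mK mp K0 p0.
have k0 : 0 <= E * 2 `^ q by rewrite mulr_ge0 ?powR_ge0// ltW.
have := integral_affine_le (@leb2 R) k0 Kp0 Kh0 W0 mKp mKh mW.
move=> hh; apply: (le_trans (hh _)) => [x|].
  have K1 := kakeya_le1 x N1 mf f01.
  have Kfin : kakeya N f x \is a fin_num by rewrite ge0_fin_numE// (le_lt_trans K1)// ltry.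
  have th1 : 1 <= q / 2 by rewrite ler_pdivlMr ?mul1r.
  have := kakeya_power_le x N1 th1 mf f0.
  rewrite (_ : 2 * (q / 2) = q); last by field.
  rewrite -/h => hq2.
  apply: (@le_trans _ _ (E%:E * kakeya N f x `^ q + W x)%E); last first.
    rewrite leeD2r// EFinM -muleA; apply: lee_wpmul2l => //.
    by rewrite lee_fin ltW.
  have v0 : 0 <= fine (kakeya N f x) by exact: fine_ge0.
  have v1 : fine (kakeya N f x) <= 1 by rewrite -lee_fin fineK.
  rewrite -(fineK Kfin) !poweR_EFin.
  apply: (@le_trans _ _ ((E * fine (kakeya N f x) `^ q + (expR 1 + enorm x) ^- 4)%:E)); last first.
    by rewrite EFinD EFinM leeD2l.
  rewrite lee_fin; exact: powR_exponent_change.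
rewrite IW.
apply: (@le_trans _ _ ((E * 2 `^ q)%:E * ((C * ln N ^+ 2) * (E + w))%:E + w%:E)%E).
  rewrite leeD2r//; apply: lee_wpmul2l; first by rewrite lee_fin.
  apply: (le_trans (hC N h eN mh)); rewrite [leRHS]EFinM.
  apply: lee_wpmul2l; first by rewrite lee_fin mulr_ge0 ?sqr_ge0// ltW.
  apply: le_trans hq; rewrite le_eqVlt; apply/orP; left; apply/eqP.
  by apply: eq_integral => y _; congr EFin; rewrite ger0_norm.
rewrite -EFinM -EFinD lee_fin.
have l2 : 1 <= ln N ^+ 2 by rewrite exprn_ege1.
have : w <= w * ln N ^+ 2 by rewrite ler_peMr.
rewrite (_ : E * 2 `^ q * (C * ln N ^+ 2 * (E + w)) = E * 2 `^ q * C * (E + w) * ln N ^+ 2); last by ring.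
rewrite -addrA mulrDl lerD2l mulrDl mul1r => wL.
by apply: (le_trans wL); rewrite lerDl (le_trans _ l2).
Qed.

End modular_estimates.

Section power_integrals.
Context d (T : measurableType d) (R : realType) (mu : {measure set T -> \bar R}).
Implicit Types (F : T -> \bar R) (p : T -> R).

(** As [B >= 1] and [p >= P], dividing the function by [B]^
    P^-1[divides the integrand by at least]B[at every point. This turns the modular bound of
    order]ln N ^+ 2[into the norm factor]ln N [^ (2 / P)]. *)
Lemma integral_poweR_rescale F p (k B P : R) : 0 < k -> 1 <= B -> 0 < P ->
  (forall x, P <= p x) -> measurable_fun setT p ->
  measurable_fun setT F -> (forall x, 0 <= F x)%E ->
  (\int[mu]_x ((k^-1%:E * F x) `^ p x) <= B%:E)%E ->
  (\int[mu]_x (((k * B `^ P^-1)^-1%:E * F x) `^ p x) <= 1)%E.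
Proof.
move=> k0 B1 P0 hP mp mF F0 h.
have B0 : 0 < B by lra.
have p0 x : 0 < p x by apply: lt_le_trans (hP x).
pose b := B `^ P^-1.
have b1 : 1 <= b by rewrite /b -(powRr0 B) ler_powR// invr_ge0 ltW.
have b0 : 0 < b by lra.
have mkF (r : R) : measurable_fun setT (fun x => r%:E * F x)%E by exact: emeasurable_funM.
have kF0 (r : R) x : 0 <= r -> (0 <= r%:E * F x)%E by move=> r0; rewrite mule_ge0.
have ki : 0 <= k^-1 by rewrite invr_ge0 ltW.
have bki : 0 <= (k * b)^-1 by rewrite invr_ge0 mulr_ge0// ltW.
have mG : measurable_fun setT (fun x => (k^-1%:E * F x) `^ p x)%E.
  by apply: measurable_poweR_fun => // x; exact: kF0.
apply: (@le_trans _ _ (\int[mu]_x (B^-1%:E * (k^-1%:E * F x) `^ p x))%E).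
  apply: ge0_le_integral => //.
  - by move=> x _; exact: poweR_ge0.
  - by apply: measurable_poweR_fun => // x; exact: kF0.
  - exact: emeasurable_funM.
  move=> x _; rewrite -/b invfM mulrC EFinM -muleA [leLHS]poweRM; last 2 first.
  - by rewrite lee_fin invr_ge0 ltW.
  - exact: kF0.
  apply: lee_wpmul2r; first exact: poweR_ge0.
  rewrite poweR_EFin lee_fin.
  apply: (@le_trans _ _ (b^-1 `^ P)).
    by apply: ger_powR; rewrite ?hP// invr_gt0 b0 invf_le1.
  by rewrite -powR_inv1 ?(ltW b0)// -powRrM mulN1r powRN /b -powRrM mulVf ?gt_eqF// powRr1// ltW.
rewrite ge0_integralZl_EFin//; first last.
- by rewrite invr_ge0 ltW.
- by move=> x _; exact: poweR_ge0.
apply: (@le_trans _ _ (B^-1%:E * B%:E)%E).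
  by apply: lee_wpmul2l => //; rewrite lee_fin invr_ge0 ltW.
by rewrite -EFinM mulVf ?gt_eqF.
Qed.

Lemma integral_poweR_shrink F p (M : R) : 1 <= M ->
  (forall x, 1 <= p x) -> measurable_fun setT p ->
  measurable_fun setT F -> (forall x, 0 <= F x)%E ->
  (\int[mu]_x (F x `^ p x) <= M%:E)%E ->
  (\int[mu]_x ((M^-1%:E * F x) `^ p x) <= 1)%E.
Proof.
move=> M1 p1 mp mF F0 h.
have := @integral_poweR_rescale F p 1 M 1 ltr01 M1 ltr01 p1 mp mF F0.
rewrite invr1 powRr1 ?mul1r; last by lra.
by apply; under eq_integral do rewrite mul1e.
Qed.

Lemma le_integral_poweR F G p : (forall x, 0 < p x) -> measurable_fun setT p ->
  measurable_fun setT F -> measurable_fun setT G -> (forall x, 0 <= F x)%E ->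
  (forall x, F x <= G x)%E ->
  (\int[mu]_x (F x `^ p x) <= \int[mu]_x (G x `^ p x))%E.
Proof.
move=> p0 mp mF mG F0 FG.
have G0 x : (0 <= G x)%E by apply: le_trans (FG x).
apply: le_integralT.
- by move=> x; exact: poweR_ge0.
- exact: measurable_poweR_fun.
- exact: measurable_poweR_fun.
- by move=> x; apply: le_poweR => //; exact: ltW.
Qed.

Lemma integral_normZ (S : set T) (f : T -> R) (k : R) : measurable S ->
  measurable_fun setT f -> 0 <= k ->
  (\int[mu]_(y in S) `|(k * f y)%:E| = k%:E * \int[mu]_(y in S) `|(f y)%:E|)%E.
Proof.
move=> mS mf k0; rewrite -ge0_integralZl_EFin//; last exact: measurable_abse_EFin.
by apply: eq_integral => y _; rewrite EFinM abseM gee0_abs.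
Qed.

End power_integrals.

Section kakeya_modular.
Context {R : realType}.
Implicit Types (p f : plane R -> R) (x y : plane R).

Lemma kakeyaZ_le (N k : R) f x : 1 <= N -> 0 < k -> measurable_fun setT f ->
  (k%:E * kakeya N f x <= kakeya N (fun y => (k * f y)%R) x)%E.
Proof.
move=> N1 k0 mf; rewrite -lee_pdivlMl//; apply: ge_ereal_sup => _ [S [RS Sx] <-].
rewrite lee_pdivlMl//; apply: le_trans (average_le_kakeya _ RS Sx).
have mS := rectangles_measurable RS.
by rewrite !(averageE _ N1 RS) (integral_normZ _ mS mf (ltW k0)) muleCA.
Qed.

Lemma kakeya_modular_le p (cinf q : R) : (forall y, 2 <= p y) -> 2 <= q ->
  measurable_fun setT p ->
  (forall x, `|p x - q| * ln (expR 1 + enorm x) <= cinf) ->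
  exists2 C : R, 1 <= C & forall (N c : R) f, expR 1 <= N -> 0 < c ->
  modified_log_holder N c p -> measurable_fun setT f ->
  (modular p (EFin \o f) <= 1)%E ->
  (\int[leb2]_x (((24 * N `^ c)^-1%:E * kakeya N f x) `^ p x) <=
    (C * (ln N) ^+ 2)%:E)%E.
Proof.
move=> p2 q2 mp hp; have [C1 C10 hC1] := @integral_local_le R.
have [C2 C20 hC2] := integral_global_le p2 q2 mp hp.
exists (C1 + C2 + 1); first by lra.
move=> N c f eN c0 mlh mf fp.
have [_ /ltW N1 N0 l1] := expR1_le_facts eN.
have p0 y : 0 < p y by exact: lt_le_trans (ltr0n _ 2) (p2 y).
have mnf : measurable_fun setT (fun y => `|f y|).
  exact: measurableT_comp.
pose f1 y := if 1 <= `|f y| then `|f y| else 0.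
pose f2 y := if 1 <= `|f y| then 0 else `|f y|.
have mb : measurable_fun setT (fun y => 1 <= `|f y|).
  exact: (measurable_fun_ler (measurable_cst (1 : R)) mnf).
have m0 := @measurable_cst _ _ (plane R) R setT (0 : R).
have mf1 : measurable_fun setT f1 by exact: (measurable_fun_ifT mb mnf m0).
have mf2 : measurable_fun setT f2 by exact: (measurable_fun_ifT mb m0 mnf).
have f10 y : 0 <= f1 y by rewrite /f1; case: ifP.
have f20 y : 0 <= f2 y by rewrite /f2; case: ifP.
have f12 y : `|f y| = f1 y + f2 y.
  by rewrite /f1 /f2; case: ifP; rewrite ?addr0 ?add0r.
have f11 y : f1 y != 0 -> 1 <= f1 y by rewrite /f1; case: ifP => // _; rewrite eqxx.
have f21 y : 0 <= f2 y <= 1.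
  rewrite f20 /f2; case: ifPn => [_|]; first exact: ler01.
  by rewrite -ltNge => /ltW.
have mEp (g : plane R -> R) : measurable_fun setT g ->
    measurable_fun setT (fun y => (g y `^ p y)%:E).
  by move=> mg; apply/measurable_EFinP; exact: measurable_powR_fun.
have part (g : plane R -> R) : measurable_fun setT g -> (forall y, 0 <= g y) ->
    (forall y, g y <= `|f y|) -> (\int[leb2]_y (g y `^ p y)%:E <= 1)%E.
  move=> mg g0 gf; apply: le_trans fp.
  rewrite (_ : modular p _ = \int[leb2]_y (`|f y|%R `^ p y)%:E)%E; last first.
    by apply: eq_integral => y _ /=.
  apply: le_integralT; [|exact: mEp|exact: mEp|].
    by move=> y; rewrite lee_fin powR_ge0.
  move=> y; rewrite lee_fin; apply: ge0_ler_powR; rewrite ?nnegrE//.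
  exact: ltW.
have i1 := hC1 N c p f1 eN c0 mlh p2 mp mf1 f10 f11 (part f1 mf1 f10 _).
have i2 := hC2 N f2 eN mf2 f21 (part f2 mf2 f20 _).
set k := 12 * N `^ c in i1.
have Nc1 : 1 <= N `^ c by rewrite -(powRr0 N) ler_powR// ltW.
have k1 : 1 <= k by rewrite /k -[leLHS]mulr1 ler_pM// ler1n.
have k0 : 0 < k by exact: lt_le_trans ltr01 k1.
have ki0 : 0 <= k^-1 by rewrite invr_ge0 ltW.
have K0 g x : (0 <= kakeya N g x)%E by exact: kakeya_ge0.
have mK g : measurable_fun setT g -> measurable_fun setT (kakeya N g) by exact: measurable_kakeya.
have mZ (r : R) (F : plane R -> \bar R) : measurable_fun setT F ->
    measurable_fun setT (fun x => r%:E * F x)%E.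
  by move=> mF; apply: emeasurable_funM mF; exact: measurable_cst.
have Z0 (r : R) g x : 0 <= r -> (0 <= r%:E * kakeya N g x)%E.
  by move=> r0; rewrite mule_ge0.
(* The extra 2 is for [half_add_poweR_le]. The small part needs no division by [k], but tolerates it
   since [k >= 1]. *)
have kE : (24 * N `^ c)^-1 = 2^-1 * k^-1.
  by rewrite -invfM /k mulrA; congr (_ * _)^-1; rewrite -natrM.
have ki24 : 0 <= (24 * N `^ c)^-1 by rewrite kE mulr_ge0// invr_ge0.
have := @integral_affine_le _ _ _ (@leb2 R)
  (fun x => ((24 * N `^ c)^-1%:E * kakeya N f x) `^ p x)%E
  (fun x => (k^-1%:E * kakeya N f1 x) `^ p x)%E
  (fun x => kakeya N f2 x `^ p x)%E 1 ler01
  (fun x => poweR_ge0 _ _) (fun x => poweR_ge0 _ _) (fun x => poweR_ge0 _ _).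
move=> /(_ (measurable_poweR_fun (mZ _ _ (mK f mf)) mp (fun x => Z0 _ f x ki24) p0)).
move=> /(_ (measurable_poweR_fun (mZ _ _ (mK f1 mf1)) mp (fun x => Z0 _ f1 x ki0) p0)).
move=> /(_ (measurable_poweR_fun (mK f2 mf2) mp (K0 f2) p0)) h.
apply: (le_trans (h _)) => [x|].
  rewrite mul1e; apply: le_trans (half_add_poweR_le (ltW (p0 x)) (Z0 _ f1 x ki0) (K0 f2 x)).
  apply: le_poweR; [exact: ltW|exact: Z0|].
  rewrite kE EFinM -muleA; apply: lee_wpmul2l; first by rewrite lee_fin invr_ge0.
  apply: (@le_trans _ _ (k^-1%:E * (kakeya N f1 x + kakeya N f2 x))%E).
    apply: lee_wpmul2l; first by rewrite lee_fin.
    exact: (kakeya_leD x N1 mf1 mf2 f12 f10 f20).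
  rewrite ge0_muleDr//; apply: leeD => //.
  rewrite -[leRHS]mul1e; apply: lee_wpmul2r => //.
  by rewrite lee_fin invf_le1.
rewrite mul1e; apply: (le_trans (leeD (i1 _) (i2 _))).
- by move=> y; rewrite f12 lerDl.
- by move=> y; rewrite f12 lerDr.
rewrite -EFinD lee_fin -mulrDl; apply: ler_wpM2r; first exact: sqr_ge0.
by rewrite lerDl.
Qed.

End kakeya_modular.

(** * From the unit modular ball to the operator norm *)

Section from_modular_to_norm.
Context {R : realType} (p : plane R -> R) (N A : R).
Implicit Types f : plane R -> R.
Context (p1 : forall x, 1 <= p x) (mp : measurable_fun setT p) (N1 : 1 <= N) (A0 : 0 < A).
Context (hA : forall f, measurable_fun setT f -> (modular p (EFin \o f) <= 1)%E ->
  (\int[leb2]_x ((A^-1%:E * kakeya N f x) `^ p x) <= 1)%E).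

Let p0 x : 0 < p x. Proof. exact: lt_le_trans ltr01 (p1 x). Qed.

Lemma measurable_Zl (l : R) f : measurable_fun setT f ->
  measurable_fun setT (fun y : plane R => l * f y).
Proof. by move=> mf; apply: measurable_funM mf; exact: measurable_cst. Qed.

Lemma modular_kakeya_le1 f (l : R) : 0 < l -> measurable_fun setT f ->
  (modular p (scale l (EFin \o f)) <= 1)%E ->
  (modular p (scale (A * l) (kakeya N f)) <= 1)%E.
Proof.
move=> l0 mf fl; have mlf := measurable_Zl l^-1 mf.
have mK g : measurable_fun setT g -> measurable_fun setT (kakeya N g) by exact: measurable_kakeya.
have mZ (r : R) (F : plane R -> \bar R) : measurable_fun setT F ->
    measurable_fun setT (fun x => r%:E * F x)%E.
  by move=> mF; apply: emeasurable_funM mF; exact: measurable_cst.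
have Z0 (r : R) g x : 0 <= r -> (0 <= r%:E * kakeya N g x)%E.
  by move=> r0; rewrite mule_ge0// kakeya_ge0.
have Al0 : 0 <= (A * l)^-1 by rewrite invr_ge0 mulr_ge0// ltW.
have Ai0 : 0 <= A^-1 by rewrite invr_ge0 ltW.
apply: le_trans (hA mlf _); last first.
  by apply: le_trans fl; rewrite le_eqVlt eqxx.
rewrite /modular /scale.
have -> : (\int[leb2]_x (`|(A * l)^-1%:E * kakeya N f x| `^ p x) =
   \int[leb2]_x (((A * l)^-1%:E * kakeya N f x) `^ p x))%E.
  by apply: eq_integral => x _; rewrite gee0_abs// Z0.
apply: (le_integral_poweR _ p0 mp (mZ _ _ (mK _ mf)) (mZ _ _ (mK _ mlf))).
- by move=> x; exact: Z0.
move=> x; rewrite invfM EFinM -muleA; apply: lee_wpmul2l; first by rewrite lee_fin.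
apply: kakeyaZ_le => //; by rewrite invr_gt0.
Qed.

Lemma in_Lp_scale_le1 f : in_Lp p (EFin \o f) -> measurable_fun setT f /\
  exists2 l : R, 0 < l & (modular p (scale l (EFin \o f)) <= 1)%E.
Proof.
move=> [mEf [l l0 fl]]; have mf : measurable_fun setT f by exact/measurable_EFinP.
split => //; set I := modular _ _ in fl.
have I0 : (0 <= I)%E by apply: integral_ge0 => x _; exact: poweR_ge0.
have If : I \is a fin_num by rewrite ge0_fin_numE.
(* Adding 1 ensures [M >= 1]; since [p >= 1], dividing by [M] then brings the modular below 1. *)
pose M := fine I + 1.
have M1 : 1 <= M by rewrite lerDr fine_ge0.
have M0 : 0 < M by exact: lt_le_trans ltr01 M1.
exists (l * M); first by rewrite mulr_gt0.
have mS : measurable_fun setT (fun x => `|scale l (EFin \o f) x|%E).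
  apply: measurable_abse_EFin (fun x => l^-1 * f x) _; exact: measurable_Zl.
have IM : (\int[leb2]_x (`|scale l (EFin \o f) x| `^ p x) <= M%:E)%E.
  apply: (@le_trans _ _ I); first by rewrite le_eqVlt eqxx.
  by rewrite -(fineK If) lee_fin lerDl.
apply: le_trans (integral_poweR_shrink M1 p1 mp mS (fun x => abse_ge0 _) IM).
rewrite le_eqVlt; apply/orP; left; apply/eqP; apply: eq_integral => x _.
rewrite -[LHS]/((`|(l * M)^-1 * f x|%R%:E) `^ p x)%E.
rewrite -[RHS]/(((M^-1 * `|l^-1 * f x|)%R%:E) `^ p x)%E; congr (_%:E `^ _)%E.
by rewrite invfM !normrM mulrA (gtr0_norm (x := M^-1)) ?invr_gt0// [`|_| * M^-1]mulrC.
Qed.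

Lemma kakeya_op_bound : op_bound p (kakeya N) A.
Proof.
move=> f [mEf _]; have mf : measurable_fun setT f by exact/measurable_EFinP.
rewrite -lee_pdivrMl//; apply: le_ereal_inf_tmp => _ [l [l0 fl] <-].
rewrite lee_pdivrMl// -EFinM; apply: ereal_inf_lbound.
exists (A * l) => //; split; first by rewrite mulr_gt0.
exact: modular_kakeya_le1.
Qed.

Lemma kakeya_bounded_Lp : bounded_Lp p (kakeya N).
Proof.
split; last by exists A; [exact: ltW|exact: kakeya_op_bound].
move=> f /in_Lp_scale_le1[mf [l l0 fl]]; split; first exact: measurable_kakeya.
exists (A * l); first by rewrite mulr_gt0.
by apply: le_lt_trans (modular_kakeya_le1 l0 mf fl) _; rewrite ltry.
Qed.

Lemma kakeya_op_norm_le : (op_norm p (kakeya N) <= A%:E)%E.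
Proof.
apply: ereal_inf_lbound; exists A => //; split; first exact: ltW.
exact: kakeya_op_bound.
Qed.

End from_modular_to_norm.

Theorem theorem1p5 (R : realType) (p : plane R -> R)
    (p_ge1 : forall x : plane R, 1 <= p x)
    (mp : measurable_fun [set: plane R] p)
    (hp_minus : (2%:E <= p_minus p)%E)
    (hp_minus_plus : (p_minus p <= p_plus p)%E)
    (hp_plus : (p_plus p < +oo)%E)
    (hp_infty : log_holder_infty p) :
  exists C N0 : R, 0 < C /\ 1 < N0 /\
    forall N c : R, N0 <= N -> 0 < c -> modified_log_holder N c p ->
      bounded_Lp p (kakeya N) /\
      (op_norm p (kakeya N) <=
         (C * N `^ (fine (p_minus p) * c)
            * (ln N) `^ (2 / fine (p_minus p)))%:E)%E.
Proof.
have [cinf [q hq]] := hp_infty.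
have Pfin : p_minus p \is a fin_num.
  rewrite fin_numE; apply/andP; split; apply/eqP => h.
    by move: hp_minus; rewrite h.
  by move: (le_lt_trans hp_minus_plus hp_plus); rewrite h ltxx.
set P := fine (p_minus p).
have PE : p_minus p = P%:E by rewrite /P fineK.
have P2 : 2 <= P by rewrite -lee_fin -PE.
have P0 : 0 < P by exact: lt_le_trans (ltr0n _ 2) P2.
have aeP : \forall x \ae (@leb2 R), P <= p x.
  have := ess_inf_le (@leb2 R) (EFin \o p); apply: filterS => x.
  by rewrite -[ess_inf _ _]/(p_minus p) PE lee_fin.
have e1 : 1 < expR (1 : R) by have [_] := expR1_le_facts (lexx (expR (1 : R))).
(* Without any admissible pair the conclusion is vacuous. Otherwise a single pair upgrades the
   almost everywhere bound [P <= p x] to every point, before the constant is chosen; the constant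
   itself comes from [p] alone. *)
have [some|none] := pselect (exists N c : R,
    [/\ expR 1 <= N, 0 < c & modified_log_holder N c p]); last first.
  exists 1, (expR 1); split; [exact: ltr01|split; [exact: e1|]].
  by move=> N c eN c0 hp; exfalso; apply: none; exists N, c.
have Pp x : P <= p x.
  have [N [c [eN c0 hp]]] := some.
  have N1 := lt_le_trans e1 eN.
  apply: (ae_ge_everywhere N1 c0 P0 hp _ aeP) => y.
  exact: lt_le_trans ltr01 (p_ge1 y).
have p2 x : 2 <= p x by exact: le_trans (Pp x).
have q2 : 2 <= q by apply: le_trans P2 _; exact: log_holder_limit_ge hq.
have [C C1 hC] := kakeya_modular_le p2 q2 mp hq.
have C0 : 0 < C by exact: lt_le_trans ltr01 C1.
exists (24 * C `^ P^-1), (expR 1); split; first by rewrite mulr_gt0// powR_gt0.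
split; first exact: e1.
move=> N c eN c0 hp.
have [_ /ltW N1 N0 l1] := expR1_le_facts eN.
have l0 : 0 <= ln N by exact: le_trans l1.
pose k := 24 * N `^ c; have k0 : 0 < k by rewrite mulr_gt0// powR_gt0.
pose B := C * ln N ^+ 2.
have l2 : 1 <= ln N ^+ 2 by rewrite exprn_ege1.
have B1 : 1 <= B by rewrite -[1]mulr1 ler_pM.
pose A := k * B `^ P^-1.
have A0 : 0 < A by rewrite mulr_gt0// powR_gt0// (lt_le_trans ltr01 B1).
have hA f : measurable_fun setT f -> (modular p (EFin \o f) <= 1)%E ->
    (\int[leb2]_x ((A^-1%:E * kakeya N f x) `^ p x) <= 1)%E.
  move=> mf fp; have K0 x := kakeya_ge0 f x N1.
  exact: (integral_poweR_rescale k0 B1 P0 Pp mp (measurable_kakeya N1 mf) K0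
    (hC N c f eN c0 hp mf fp)).
split; first exact: (kakeya_bounded_Lp p_ge1 mp N1 A0 hA).
apply: (le_trans (kakeya_op_norm_le p_ge1 mp N1 A0 hA)); rewrite lee_fin.
have -> : A = 24 * C `^ P^-1 * N `^ c * ln N `^ (2 / P).
  rewrite /A /k /B powRM ?exprn_ge0 ?(ltW C0)// -powR_mulrn// -powRrM; ring.
apply: ler_wpM2r; first exact: powR_ge0.
apply: ler_wpM2l; first by rewrite mulr_ge0// powR_ge0.
(* The argument yields the exponent [c], which is at most [P * c]. *)
apply: ler_powR => //.
by rewrite ler_peMl ?(ltW c0)// (le_trans _ P2)// ler1n.
Qed.
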